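(* The number of cusps of $X_0(\mathfrak N)$ is equal to $$h^+h\sum_{\mathfrak M\mid\mathfrak N}\varphi_{>0}(\mathfrak M+\mathfrak N/\mathfrak M),$$ where for a nonzero integral ideal $\mathfrak M$ one sets $\varphi_{>0}(\mathfrak M)=\#\bigl((R/\mathfrak M)^\times/R_{>0}^\times\bigr)$.
   Context: $F$ is a totally real number field with ring of integers $R$, class number $h=\#\mathrm{Cl}\,R$ and narrow class number $h^+=\#\mathrm{Cl}^+R$; $R_{>0}^\times$ is the group of totally positive units, and $(R/\mathfrak M)^\times/R_{>0}^\times$ denotes the quotient by the image of $R_{>0}^\times$. $\mathfrak N\subseteq R$ is a nonzero ideal, the sum is over integral ideals $\mathfrak M$ dividing $\mathfrak N$, and $\mathfrak N/\mathfrak M=\mathfrak N\mathfrak M^{-1}$. For a nonzero fractional ideal $\mathfrak b$, $\Gamma_0(\mathfrak N)_{\mathfrak b}$ is the group of matrices $\begin{pmatrix} a&b\\c&d\end{pmatrix}$ with $a,d\in R$, $b\in\mathfrak b^{-1}$, $c\in\mathfrak N\mathfrak b$, $ad-bc\in R_{>0}^\times$; its cusps are its orbits on $\mathbb P^1(F)$. $X_0(\mathfrak N)=\bigsqcup_{[\mathfrak b]\in\mathrm{Cl}^+R}X_0(\mathfrak N)_{\mathfrak b}$, so the set of cusps of $X_0(\mathfrak N)$ is the disjoint union, over representatives $\mathfrak b$ of $\mathrm{Cl}^+R$, of $\Gamma_0(\mathfrak N)_{\mathfrak b}\backslash\mathbb P^1(F)$. *)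

(* Defs.v *)
From HB Require Import structures.
From mathcomp Require Import all_boot all_order all_algebra all_field.
From mathcomp Require Import finmap.
From mathcomp Require Import boolp classical_sets functions cardinality fsbigop.

Set Implicit Arguments.
Unset Strict Implicit.
Unset Printing Implicit Defensive.

Import Order.TTheory GRing.Theory Num.Theory.
Local Open Scope classical_set_scope.
Local Open Scope ring_scope.

(* MathComp world with classical sets: a number field is
   [F : fieldExtType rat]; its ideals, their cosets and classes are sets. *)

(* Cardinality of a finite set (with value 0 on infinite sets). *)
Definition ncard (T : choiceType) (A : set T) : nat := #|` fset_set A|.

(* The set of classes of a relation r (in use: an equivalence relation on A). *)
Definition classes_of (T : Type) (A : set T) (r : T -> T -> Prop) :
    set (set T) :=
  [set [set y | A y /\ r x y] | x in A].

Section NumberField.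
Variable F : fieldExtType rat.
Implicit Types (I J M N b : set F) (x y u : F).

(* F is algebraic over Q, so its complex embeddings are exactly its ring
   morphisms to algC.  On algC, [0 < z] means that z is real and positive. *)
Definition totally_real : Prop :=
  forall (s : {rmorphism F -> algC}) x, s x \is Num.real.

Definition totally_positive x : Prop :=
  forall s : {rmorphism F -> algC}, 0 < s x.

Definition int_ring : set F :=
  [set x | integralOver (intr : int -> F) x].

Definition units_pos : set F :=
  [set u | [/\ u != 0, int_ring u, int_ring u^-1 & totally_positive u]].

Definition submodule I : Prop :=
  [/\ I 0, forall x y, I x -> I y -> I (x + y)
    & forall a x, int_ring a -> I x -> I (a * x)].

(* Both kinds of ideals are nonzero by definition. *)
Definition frac_ideal I : Prop :=
  [/\ submodule I, exists2 x, I x & x != 0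
    & exists d, [/\ d != 0, int_ring d
                  & forall x, I x -> int_ring (d * x)]].

Definition integral_ideal I : Prop :=
  [/\ submodule I, exists2 x, I x & x != 0 & I `<=` int_ring].

Definition ideal_add I J : set F := [set x + y | x in I & y in J].

Definition ideal_mul I J : set F :=
  [set z | exists2 s : seq (F * F), (forall p, p \in s -> I p.1 /\ J p.2)
         & z = \sum_(p <- s) p.1 * p.2].

Definition ideal_inv I : set F :=
  [set x | forall y, I y -> int_ring (x * y)].

Definition ideal_scale x I : set F := [set x * y | y in I].

Definition ideal_divisors N : set (set F) :=
  [set M | integral_ideal M /\
           exists2 K, integral_ideal K & N = ideal_mul M K].

Definition class_rel I J : Prop :=
  exists2 x, x != 0 & J = ideal_scale x I.

Definition narrow_class_rel I J : Prop :=
  exists x, [/\ x != 0, totally_positive x & J = ideal_scale x I].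

Definition class_group : set (set (set F)) :=
  classes_of [set I | frac_ideal I] class_rel.

Definition narrow_class_group : set (set (set F)) :=
  classes_of [set I | frac_ideal I] narrow_class_rel.

Definition class_number : nat := ncard class_group.

Definition narrow_class_number : nat := ncard narrow_class_group.

Definition narrow_class_reps (B : set (set F)) : Prop :=
  B `<=` [set I | frac_ideal I] /\
  forall C, narrow_class_group C -> exists! b, B b /\ C b.

(* R/M is handled through cosets x + M, rather than as a ring structure,
   because M = R (where R/M is the zero ring, with one unit) is allowed. *)
Definition add_coset M x : set F := [set x + m | m in M].

Definition quotient_ring M : set (set F) := [set add_coset M x | x in int_ring].

Definition coset_mul M (C D : set F) : set F :=
  [set z | exists x y, [/\ C x, D y & add_coset M (x * y) z]].

Definition quotient_units M : set (set F) :=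
  [set C | quotient_ring M C /\
           exists2 D, quotient_ring M D & coset_mul M C D = add_coset M 1].

Definition units_pos_image M : set (set F) :=
  [set add_coset M u | u in units_pos].

(* The quotient is the set of cosets of the subgroup [units_pos_image M]. *)
Definition phi_pos M : nat :=
  ncard (classes_of (quotient_units M)
    (fun C D => exists2 U, units_pos_image M U & D = coset_mul M C U)).

Definition Gamma0 N b : set 'M[F]_2 :=
  [set g : 'M[F]_2 | [/\ int_ring (g 0 0), int_ring (g 1 1),
               ideal_inv b (g 0 1), ideal_mul N b (g 1 0) & units_pos (\det g)]].

(* P^1(F) is the set of lines in the space F^2 of column vectors, on which
   matrices act by left multiplication. *)
Definition P1 : set {vspace 'cV[F]_2} := [set L | \dim L = 1%N].

Definition cusps_component N b : set (set {vspace 'cV[F]_2}) :=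
  classes_of P1
    (fun L L' => exists2 g, Gamma0 N b g & L' = (linfun (mulmx g) @: L)%VS).

(* The disjoint union, over the representatives b in B, of the cusps of
   X_0(N)_b, with elements tagged by b. *)
Definition cusps N (B : set (set F)) :
    set (set F * set {vspace 'cV[F]_2}) :=
  [set c | B c.1 /\ cusps_component N c.1 c.2].

End NumberField.

Arguments totally_real : clear implicits.
Arguments class_number : clear implicits.
Arguments narrow_class_number : clear implicits.

(* Main.v *)
From HB Require Import structures.
Require Import Defs.
From mathcomp Require Import all_boot all_order all_algebra all_field.
From mathcomp Require Import finmap.
From mathcomp Require Import boolp classical_sets functions cardinality fsbigop.
From mathcomp Require Import perm.
From mathcomp Require Import ring lra.

(** The group [Gamma0 N b] preserves the lattice [R + b] and its sublattice
    [R + N b].  Let [x, y] span a line.  The line meets the first lattice in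
    [a^-1 (x, y)], where [a = x R + y b^-1], and the second in
    [M a^-1 (x, y)] for a divisor [M] of [N]; put [K = N / M] and [D = M + K].
    The ideal class of [a] and the divisor [M] are invariants of the orbit of
    the line.  Scaling the coordinates so that [a] is a fixed representative of
    its class leaves one more invariant.  Here [x] generates [a] modulo [a K],
    [y] generates [J = a b K] modulo [J M], and therefore [x y] generates
    [Q = a J] modulo [Q D].  A matrix of the group multiplies [x y] by its
    determinant modulo [Q D] ([type_mul_congr]), and rescaling by a unit [c]
    multiplies it by [c ^ 2], which is totally positive because [F] is totally
    real.  So the class of [x y] in [(R / D)^*], taken relative to a generator
    of [Q / Q D] and modulo totally positive units, depends only on the cusp.

    These invariants are complete ([type_transitive]): two vectors with the
    same invariants are both completed to unimodular matrices, and the congruence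
    between the products of coordinates is exactly what permits a shear to bring
    the lower left entry of the transition matrix into [N b].  They take
    all values ([type_exists]), by approximation.  Each component thus has
    [h * \sum_M phi_pos D] cusps, a number in which [b] does not appear, and
    there are [h^+] components.

    The arithmetic of [R] is built on the way.  The trace form shows that
    [R / m R] is finite.  Hurwitz's pigeonhole argument ([almost_euclidean])
    puts in each ideal class an integral ideal containing a fixed integer, so
    there are finitely many classes ([bounded_class_rep]).  Two powers of an
    ideal are then in the same class, and Nakayama's lemma turns this into an
    inverse of the ideal ([frac_invertible]).  Narrow classes are finite in
    number because, within a class, the signs of a scaling factor at the
    embeddings determine the narrow class. *)

Set Implicit Arguments.
Unset Strict Implicit.
Unset Printing Implicit Defensive.

Import Order.TTheory GRing.Theory Num.Theory.
Local Open Scope classical_set_scope.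
Local Open Scope ring_scope.

(** * Counting classes by invariants *)

Lemma ncard_seq (T : choiceType) (A : set T) (s : seq T) :
  uniq s -> (forall x, A x <-> x \in s) ->
  finite_set A /\ ncard A = size s.
Proof.
move=> us As.
have eA : A = [set x | x \in s] by apply/seteqP; split => x /= /As.
have fA : finite_set A by rewrite eA; exact: finite_seq.
split => //; rewrite /ncard.
apply/perm_size/uniq_perm => // x.
by rewrite in_fset_set //; apply/idP/idP => [/set_mem/As|/As/mem_set].
Qed.

Lemma finite_inj (T : Type) (U : finType) (A : set T) (f : T -> U) :
  (forall x y, A x -> A y -> f x = f y -> x = y) -> finite_set A.
Proof.
move=> injf; have : finite_set (f @` A) by exact: finite_finset.
rewrite (@eq_finite_set _ _ _ A) //; apply: inj_card_eq => x y.
by rewrite !inE; exact: injf.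
Qed.

(** A bijection is given as a relation, because the correspondences used below
    go through choices of coordinates and residues that determine no function. *)
Lemma ncard_match (T U : choiceType) (A : set T) (B : set U)
    (rho : T -> U -> Prop) :
  finite_set B ->
  (forall a, A a -> exists2 b, B b & rho a b) ->
  (forall b, B b -> exists2 a, A a & rho a b) ->
  (forall a a' b b', A a -> A a' -> B b -> B b' -> rho a b -> rho a' b' ->
     (a = a' <-> b = b')) ->
  finite_set A /\ ncard A = ncard B.
Proof.
move=> fB tA sB bij.
have [[a0 Aa0]|A0] := pselect (exists a, A a); last first.
  have noA a : ~ A a by move=> Aa; apply: A0; exists a.
  have noB b : ~ B b by move=> /sB[a /noA].
  have [||fA ->] := @ncard_seq T A [::] => //; first by move=> x; split => // /noA.
  by have [||_ ->] := @ncard_seq U B [::] => //; move=> x; split => // /noB.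
have [g gP] : exists g : U -> T, forall b, B b -> A (g b) /\ rho (g b) b.
  have [|g gP] := @choice U T (fun b a => B b -> A a /\ rho a b); last by exists g.
  move=> b; have [/sB[a Aa ab]|nB] := pselect (B b); first by exists a.
  by exists a0.
have Bs b : b \in fset_set B <-> B b.
  by rewrite in_fset_set //; split => [/set_mem|/mem_set].
have [||fA ->] := @ncard_seq T A (map g (fset_set B)); last by rewrite size_map.
- rewrite map_inj_in_uniq // => b b' /Bs Bb /Bs Bb' /eqP.
  have [[Ab rb] [Ab' rb']] := (gP b Bb, gP b' Bb').
  by move/eqP/(bij _ _ _ _ Ab Ab' Bb Bb' rb rb').
- move=> a; split => [Aa|/mapP[b /Bs Bb ->]]; last by have [] := gP b Bb.
  have [b Bb rb] := tA a Aa; have [Ab rb'] := gP b Bb.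
  by apply/mapP; exists b; [apply/Bs | apply/(bij _ _ _ _ Aa Ab Bb Bb rb rb')].
Qed.

Section Classes.
Variables (T : choiceType) (A : set T) (r : T -> T -> Prop).

Definition class_at (x : T) : set T := [set y | A y /\ r x y].

Lemma classes_ofP C : classes_of A r C <-> exists2 x, A x & C = class_at x.
Proof.
by rewrite /classes_of /=; split => [[x Ax <-]|[x Ax ->]]; exists x.
Qed.

Lemma class_atP x y :
    (forall x, A x -> r x x) -> (forall x y, A x -> A y -> r x y -> r y x) ->
    (forall x y z, A x -> A y -> A z -> r x y -> r y z -> r x z) ->
  A x -> A y -> class_at x = class_at y <-> r x y.
Proof.
move=> refl sym trans Ax Ay; split => [exy|rxy].
  have : class_at y y by split; last exact: refl.
  by rewrite -exy => -[].
have ryx := sym _ _ Ax Ay rxy.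
by apply/seteqP; split => z [Az rz]; split=> //; apply: trans rz.
Qed.

Lemma classes_finite (U : Type) (S : set U) (key : T -> U -> Prop) :
    (forall x, A x -> r x x) -> (forall x y, A x -> A y -> r x y -> r y x) ->
    (forall x y z, A x -> A y -> A z -> r x y -> r y z -> r x z) ->
    finite_set S -> (forall x, A x -> exists2 s, S s & key x s) ->
    (forall x y s, A x -> A y -> key x s -> key y s -> r x y) ->
  finite_set (classes_of A r).
Proof.
move=> refl sym trans fS tA keyr.
have [g gP] : exists g : U -> set T, forall x s, A x -> key x s -> g s = class_at x.
  have [|g gP] := @choice _ _ (fun s C => forall x, A x -> key x s -> C = class_at x).
    move=> s; have [[x [Ax xs]]|nx] := pselect (exists x, A x /\ key x s).
      exists (class_at x) => y Ay ys; apply/class_atP => //; exact: keyr xs ys.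
    by exists set0 => x Ax xs; case: nx; exists x.
  by exists g => x s Ax xs; exact: gP.
apply: sub_finite_set (finite_image g fS) => _ /classes_ofP[x Ax ->].
by have [s Ss xs] := tA x Ax; exists s => //; exact: gP.
Qed.

(** Invariants [rho] that separate the classes make [r] an equivalence relation
    on [A], so that none of its axioms has to be checked separately. *)
Lemma classes_match (U : choiceType) (S : set U) (rho : T -> U -> Prop) :
  finite_set S ->
  (forall x, A x -> exists2 s, S s & rho x s) ->
  (forall s, S s -> exists2 x, A x & rho x s) ->
  (forall x y s t, A x -> A y -> S s -> S t -> rho x s -> rho y t ->
     (r x y <-> s = t)) ->
  finite_set (classes_of A r) /\ ncard (classes_of A r) = ncard S.
Proof.
move=> fS tA tS sep.
pose rho' C s := exists2 x, A x & C = class_at x /\ rho x s.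
apply: (@ncard_match _ _ _ _ rho') => //.
- move=> _ /classes_ofP[x Ax ->]; have [s Ss xs] := tA x Ax.
  by exists s => //; exists x.
- move=> s /[dup] Ss /tS[x Ax xs]; exists (class_at x); last by exists x.
  by apply/classes_ofP; exists x.
move=> _ _ s t _ _ Ss St [x Ax [-> xs]] [y Ay [-> yt]].
have refl z : A z -> r z z.
  by move=> Az; have [u Su zu] := tA z Az; apply/(sep _ _ _ _ Az Az Su Su zu zu).
have sym z w : A z -> A w -> r z w -> r w z.
  move=> Az Aw zw; have [[u Su zu] [v Sv wv]] := (tA z Az, tA w Aw).
  apply/(sep _ _ _ _ Aw Az Sv Su wv zu); symmetry.
  exact/(sep _ _ _ _ Az Aw Su Sv zu wv).
have trans z w w' : A z -> A w -> A w' -> r z w -> r w w' -> r z w'.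
  move=> Az Aw Aw' zw ww'.
  have [[u Su zu] [v Sv wv] [v' Sv' wv']] := And3 (tA z Az) (tA w Aw) (tA w' Aw').
  apply/(sep _ _ _ _ Az Aw' Su Sv' zu wv').
  rewrite (sep _ _ _ _ Az Aw Su Sv zu wv).1 //.
  exact/(sep _ _ _ _ Aw Aw' Sv Sv' wv wv').
by rewrite class_atP // (sep _ _ _ _ Ax Ay Ss St xs yt).
Qed.

End Classes.

Lemma ncard_sigma (I J : choiceType) (X : set I) (Y : I -> set J) :
  finite_set X -> (forall i, X i -> finite_set (Y i)) ->
  finite_set [set p : I * J | X p.1 /\ Y p.1 p.2] /\
  ncard [set p : I * J | X p.1 /\ Y p.1 p.2] =
    \big[addn/0%N]_(i \in X) ncard (Y i).
Proof.
move=> fX fY.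
have Xs i : (i \in fset_set X) = (i \in X) by rewrite in_fset_set.
have Ys i j : X i -> (j \in fset_set (Y i)) = (j \in Y i).
  by move=> Xi; rewrite in_fset_set //; exact: fY.
have [||fA ->] := @ncard_seq _ [set p : I * J | X p.1 /\ Y p.1 p.2]
  [seq (i, j) | i <- fset_set X, j <- fset_set (Y i)].
- by apply: allpairs_uniq_dep => // [[i j] [i' j']] _ _ [-> ->].
- move=> [i j]; split => /= [[Xi Yij]|/allpairsPdep[i' [j' [+ + [-> ->]]]]].
    apply/allpairsPdep; exists i, j; rewrite Xs Ys //.
    by split => //; exact/mem_set.
  by rewrite Xs => /set_mem Xi; rewrite Ys // => /set_mem.
split => //; rewrite size_allpairs_dep fsbig_finite //=.
by rewrite sumnE big_map.
Qed.

Lemma sum_const (I : choiceType) (X : set I) (k : nat) :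
  finite_set X -> \big[addn/0%N]_(i \in X) k = (ncard X * k)%N.
Proof.
move=> fX; rewrite fsbig_finite //= big_const_seq count_predT iter_addn_0 mulnC.
by [].
Qed.

(** * The ring of integers as a lattice *)

Import VectorInternalTheory.

Section Integers.
Variable F : fieldExtType rat.
Implicit Types x y z : F.
Let R : set F := @int_ring F.
Let n := dim F.

Lemma int_int (m : int) : R m%:~R. Proof. exact: integral_id. Qed.
Lemma int_nat (m : nat) : R m%:R. Proof. exact: integral_nat. Qed.
Lemma int0 : R 0. Proof. exact: integral0. Qed.
Lemma int1 : R 1. Proof. exact: integral1. Qed.
Lemma intN x : R x -> R (- x). Proof. exact: integral_opp. Qed.
Lemma intD x y : R x -> R y -> R (x + y). Proof. exact: integral_add. Qed.
Lemma intB x y : R x -> R y -> R (x - y). Proof. exact: integral_sub. Qed.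
Lemma intM x y : R x -> R y -> R (x * y). Proof. exact: integral_mul. Qed.
Lemma intX x k : R x -> R (x ^+ k).
Proof. by move=> Rx; elim: k => [|k IH]; rewrite ?exprS; [exact: int1|exact: intM]. Qed.

(** Integrality through a finitely generated module: [y] is a root of the
    characteristic polynomial of an integer matrix having [y] as eigenvalue. *)
Lemma int_eigenvalue m (Z : 'M[int]_m) (v : 'rV[F]_m) y :
  v != 0 -> v *m map_mx intr Z = y *: v -> R y.
Proof.
move=> v0 vZ; have : eigenvalue (map_mx intr Z) y by apply/eigenvalueP; exists v.
rewrite eigenvalue_root_char -map_char_poly => ry.
by exists (char_poly Z); [exact: char_poly_monic|].
Qed.

Definition coordv x : 'rV[rat]_n := v2r x.
Lemma coordv_is_linear : linear coordv.
Proof. by move=> a x y; rewrite /coordv linearD linearZ. Qed.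
HB.instance Definition _ := GRing.isLinear.Build rat F 'rV[rat]_n *:%R coordv
  coordv_is_linear.
Definition ofcoord (u : 'rV[rat]_n) : F := @r2v rat F u.
Lemma ofcoord_is_linear : linear ofcoord.
Proof. by move=> a x y; rewrite /ofcoord linearD linearZ. Qed.
HB.instance Definition _ := GRing.isLinear.Build rat 'rV[rat]_n F *:%R ofcoord
  ofcoord_is_linear.
Lemma ofcoordK : cancel ofcoord coordv. Proof. exact: r2vK. Qed.
Lemma coordvK : cancel coordv ofcoord. Proof. exact: v2rK. Qed.

Definition mulmat x : 'M[rat]_n :=
  \matrix_i coordv (x * ofcoord (delta_mx 0 i)).

Lemma coordv_mul x y : coordv (x * y) = coordv y *m mulmat x.
Proof.
rewrite -{1}[y]coordvK [coordv y in LHS]row_sum_delta linear_sum mulr_sumr.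
rewrite linear_sum mulmx_sum_row; apply: eq_bigr => i _.
by rewrite linearZ /= -scalerAr linearZ rowK.
Qed.

Lemma coordv_inj : injective coordv. Proof. exact: (can_inj coordvK). Qed.

Lemma mulmatP x (A : 'M_n) :
  (forall y, coordv (x * y) = coordv y *m A) -> mulmat x = A.
Proof.
move=> xA; apply/row_matrixP => i; rewrite rowK xA ofcoordK.
by rewrite -rowE.
Qed.

Lemma mulmatD x y : mulmat (x + y) = mulmat x + mulmat y.
Proof.
by apply: mulmatP => z; rewrite mulrDl linearD mulmxDr -!coordv_mul.
Qed.
Lemma mulmatZ a x : mulmat (a *: x) = a *: mulmat x.
Proof.
by apply: mulmatP => z; rewrite -scalerAl linearZ -scalemxAr -coordv_mul.
Qed.
Lemma mulmatM x y : mulmat (x * y) = mulmat x *m mulmat y.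
Proof.
by apply: mulmatP => z; rewrite mulmxA -!coordv_mul mulrCA mulrA.
Qed.
Lemma mulmat1 : mulmat 1 = 1%:M.
Proof. by apply: mulmatP => z; rewrite mul1r mulmx1. Qed.
Lemma mulmat_int (m : int) : mulmat m%:~R = m%:~R%:M.
Proof.
apply: mulmatP => z; by rewrite mulrzl mul_mx_scalar scaler_int raddfMz.
Qed.
Lemma mulmat_sum (I : Type) (r : seq I) P (E : I -> F) :
  mulmat (\sum_(i <- r | P i) E i) = \sum_(i <- r | P i) mulmat (E i).
Proof.
elim/big_rec2: _ => [|i y1 y2 _ <-]; last by rewrite mulmatD.
by apply: mulmatP => y; rewrite mul0r mulmx0 /coordv linear0.
Qed.
Lemma dim_gt0 : (0 < n)%N.
Proof.
rewrite lt0n; apply/eqP => n0; have : (1 : F) == 0; last by rewrite oner_eq0.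
apply/eqP/coordv_inj/rowP => i; exfalso; move: (ltn_ord i); rewrite [X in (_ < X)%N]n0.
by rewrite ltn0.
Qed.

Definition norm x : rat := \det (mulmat x).
Definition trace x : rat := \tr (mulmat x).

Lemma normM x y : norm (x * y) = norm x * norm y.
Proof. by rewrite /norm mulmatM det_mulmx. Qed.
Lemma norm1 : norm 1 = 1. Proof. by rewrite /norm mulmat1 det1. Qed.
Lemma norm_eq0 x : (norm x == 0) = (x == 0).
Proof.
apply/eqP/eqP => [nx|->]; last first.
  have -> : norm 0 = norm ((0 : rat) *: 1) by rewrite scale0r.
  by rewrite /norm mulmatZ detZ expr0n eqn0Ngt dim_gt0 mul0r.
apply/eqP; apply: contraTT isT => x0.
have := norm1; rewrite -(mulfV x0) normM nx mul0r => /esym/eqP.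
by rewrite oner_eq0.
Qed.

(** The eigenvalues of multiplication by an algebraic integer are algebraic
    integers, since every integer polynomial that kills the element kills them. *)
Lemma root_mulmat x (A : algC) :
  R x -> root (map_poly ratr (char_poly (mulmat x))) A -> A \in Aint.
Proof.
move=> [p mon_p px0].
rewrite map_char_poly -eigenvalue_root_char => /eigenvalueP[v vA v0].
have horner_v (q : {poly int}) :
    v *m map_mx ratr (mulmat (map_poly intr q).[x]) = (map_poly intr q).[A] *: v.
  elim/poly_ind: q => [|q c IH].
    rewrite !rmorph0 !horner0 -[0 : F](rmorph0 intr) mulmat_int.
    by rewrite raddf0 map_mx0 mulmx0 scale0r.
  rewrite !rmorphD !rmorphM /= !map_polyX !map_polyC /= !hornerMXaddC.
  rewrite mulmatD mulmatM map_mxD map_mxM mulmxDr mulmxA IH -scalemxAl vA scalerA.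
  by rewrite mulmat_int map_scalar_mx mul_mx_scalar rmorph_int scalerDl.
have /eqP := horner_v p.
rewrite (rootP px0) -[0 : F](rmorph0 intr) mulmat_int raddf0 map_mx0 mulmx0.
rewrite eq_sym scaler_eq0 (negPf v0) orbF => pA0.
apply: (root_monic_Aint (p := map_poly intr p)) => //.
  exact: monic_map.
by apply/polyOverP => i; rewrite coef_map /= intr_int.
Qed.

(** The coefficients are symmetric functions of algebraic integers, hence
    rational numbers that are algebraic integers. *)
Lemma char_poly_int x i : R x -> (char_poly (mulmat x))`_i \in Num.int.
Proof.
move=> Rx; rewrite -Cint_rat; set p := char_poly _.
have -> : ratr p`_i = (map_poly ratr p)`_i :> algC by rewrite coef_map.
apply: Cint_rat_Aint; first by rewrite coef_map Crat_rat.
have [s ps] := closed_field_poly_normal (map_poly (ratr : rat -> algC) p).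
have /monicP lead1 : map_poly (ratr : rat -> algC) p \is monic.
  by rewrite monic_map // char_poly_monic.
suff : map_poly (ratr : rat -> algC) p \is a polyOver Aint by move/polyOverP.
rewrite ps lead1 scale1r big_seq rpred_prod // => z zs.
rewrite polyOverXsubC; apply: root_mulmat Rx _.
by rewrite -/p ps lead1 scale1r root_prod_XsubC.
Qed.

Lemma trace_int x : R x -> trace x \in Num.int.
Proof.
move=> Rx; have := char_poly_int (dim F).-1 Rx.
by rewrite char_poly_trace ?dim_gt0 // rpredN.
Qed.

Lemma norm_int x : R x -> norm x \in Num.int.
Proof.
move=> Rx; have := char_poly_int 0 Rx.
by rewrite char_poly_det rpredMsign.
Qed.

Lemma clear_denom a b (A : 'M[rat]_(a, b)) :
  exists2 d : nat, (0 < d)%N &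
    exists Z : 'M[int]_(a, b), d%:R *: A = map_mx intr Z.
Proof.
pose d := (\prod_(p : 'I_a * 'I_b) `|denq (A p.1 p.2)|)%N.
have dA i j : d%:R * A i j \in Num.int.
  rewrite /d (bigD1 (i, j)) //= natrM [_%:R * _%:R]mulrC -mulrA rpredM ?natr_int //.
  rewrite pmulrn absz_denq mulrC -{1}[A i j]divq_num_den mulfVK ?intr_eq0 ?denq_neq0 //.
  exact: intr_int.
exists d; first by apply: prodn_gt0 => p; rewrite absz_gt0 denq_neq0.
exists (\matrix_(i, j) Num.floor (d%:R * A i j)).
by apply/matrixP => i j; rewrite !mxE floorK.
Qed.

Lemma ofcoord_sum (u : 'rV[rat]_n) :
  ofcoord u = \sum_i u 0 i *: ofcoord (delta_mx 0 i).
Proof.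
rewrite {1}[u]row_sum_delta linear_sum; apply: eq_bigr => i _.
by rewrite linearZ.
Qed.

(** Once its denominators are cleared, the matrix of multiplication by [x] is an
    integer matrix with eigenvalue a multiple of [x]. *)
Lemma int_multiple x : exists2 m : nat, (0 < m)%N & R (m%:R * x).
Proof.
have [m m0 [Z Zx]] := clear_denom (mulmat x).
exists m => //.
pose e i := ofcoord (delta_mx 0 i).
pose v : 'rV[F]_n := \row_i e i.
apply: (@int_eigenvalue _ Z^T v).
  have i0 := Ordinal dim_gt0.
  apply/eqP => /rowP/(_ i0); rewrite !mxE => /(congr1 coordv).
  rewrite linear0 ofcoordK => /rowP/(_ i0); rewrite !mxE !eqxx.
  by move/eqP; rewrite oner_eq0.
apply/rowP => i; rewrite !mxE.
have -> : m%:R * x * e i = ofcoord (row i (map_mx intr Z)).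
  rewrite -Zx linearZ /= rowK linearZ /= coordvK -mulrA.
  by rewrite [RHS]scaler_nat mulr_natl.
rewrite ofcoord_sum; apply: eq_bigr => j _; rewrite !mxE scaler_int mulrC.
by rewrite mulrzl.
Qed.

Lemma basis_multiple : exists2 D : nat, (0 < D)%N &
  forall i, R (D%:R * ofcoord (delta_mx 0 i)).
Proof.
have [m mP] : exists m : 'I_n -> nat, forall i,
    (0 < m i)%N /\ R ((m i)%:R * ofcoord (delta_mx 0 i)).
  have [|m mP] := @choice _ _ (fun (i : 'I_n) m =>
    (0 < m)%N /\ R (m%:R * ofcoord (delta_mx 0 i))); last by exists m.
  by move=> i; have [m m0 Rm] := int_multiple (ofcoord (delta_mx 0 i)); exists m.
exists (\prod_i m i)%N; first by apply: prodn_gt0 => i; have [] := mP i.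
move=> i; rewrite (bigD1 i) //= natrM [_%:R * _%:R]mulrC -mulrA.
by apply: intM; [exact: int_nat | have [] := mP i].
Qed.

Lemma traceD x y : trace (x + y) = trace x + trace y.
Proof. by rewrite /trace mulmatD mxtraceD. Qed.
Lemma traceZ a x : trace (a *: x) = a * trace x.
Proof. by rewrite /trace mulmatZ mxtraceZ. Qed.
Lemma trace_sum (I : Type) (r : seq I) (c : I -> rat) (E : I -> F) :
  trace (\sum_(i <- r) c i *: E i) = \sum_(i <- r) c i * trace (E i).
Proof.
elim/big_rec2: _ => [|i y1 y2 _ <-]; last by rewrite traceD traceZ.
by rewrite -[0 : F](scale0r (1 : F)) traceZ mul0r.
Qed.

(** The trace form takes integral values on integers and is nondegenerate, as
    [trace (y * y^-1)] is the degree; pairing with a basis of integers therefore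
    bounds the denominators of the coordinates of all integers. *)
Lemma int_coord : exists2 d : nat, (0 < d)%N &
  forall x, R x -> exists Z : 'rV[int]_n, d%:R *: coordv x = map_mx intr Z.
Proof.
have [D D0 RD] := basis_multiple.
have D0r : D%:R != 0 :> rat by rewrite pnatr_eq0 -lt0n.
pose e i := D%:R * ofcoord (delta_mx 0 i).
pose G : 'M[rat]_n := \matrix_(i, j) trace (e i * e j).
have De x : D%:R *: x = \sum_i coordv x 0 i *: e i.
  rewrite -{1}[x]coordvK ofcoord_sum scaler_sumr; apply: eq_bigr => i _.
  by rewrite /e mulr_natl scalerA mulrC -scalerA scaler_nat.
have GE x j : (coordv x *m G) 0 j = trace (D%:R *: x * e j).
  rewrite De mulr_suml mxE.
  under [in RHS]eq_bigr do rewrite -scalerAl.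
  by rewrite trace_sum; apply: eq_bigr => i _; rewrite mxE.
have Gu : G \in unitmx.
  rewrite -row_free_unit; apply/inj_row_free => v vG.
  rewrite -[v]ofcoordK; set y := ofcoord v; suff -> : y = 0 by rewrite linear0.
  apply/eqP; apply: contraTT isT => y0; exfalso.
  have: trace (y * (D%:R *: (D%:R *: y^-1))) = 0.
    rewrite [D%:R *: y^-1]De -scalerAr scalerAl mulr_sumr.
    under eq_bigr do rewrite -scalerAr.
    rewrite trace_sum big1 // => i _.
    by rewrite -GE ofcoordK vG mxE mulr0.
  rewrite -!scalerAr mulfV // !traceZ => /eqP.
  rewrite !mulf_eq0 !(negPf D0r) /= /trace mulmat1 mxtrace1 pnatr_eq0.
  by rewrite eqn0Ngt dim_gt0.
have [d d0 [Z dZ]] := clear_denom (invmx G).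
exists d => // x Rx.
have TZ j : (coordv x *m G) 0 j \in Num.int.
  rewrite GE scaler_nat -mulr_natl -mulrA [x * _]mulrC mulrA; apply: trace_int.
  by apply: intM => //; apply: intM; [exact: int_nat | exact: RD].
pose T : 'rV[int]_n := \row_j Num.floor ((coordv x *m G) 0 j).
exists (T *m Z); rewrite map_mxM -dZ -scalemxAr.
suff -> : map_mx intr T = coordv x *m G by rewrite mulmxK.
by apply/rowP => j; rewrite [LHS]mxE [T _ _]mxE floorK ?TZ.
Qed.

(** An integer is classified by its coordinates, cleared of the denominator [d]
    and reduced modulo [d * (m * D)]: when these agree, the difference is [m]
    times a combination of the integers [D%:R * ofcoord (delta_mx 0 i)]. *)
Lemma int_mod_finite : exists2 D : nat, (0 < D)%N &
  (forall i, R (D%:R * ofcoord (delta_mx 0 i))) /\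
  forall m : nat, (0 < m)%N -> exists s : seq F, (forall y, y \in s -> R y) /\
    forall x, R x -> exists2 y, y \in s &
      exists Z : 'rV[int]_n, x - y = (m * D)%:R * ofcoord (map_mx intr Z).
Proof.
have [D D0 RD] := basis_multiple; have [d d0 dP] := int_coord.
exists D => //; split => // m m0.
pose q := (d * (m * D))%N.
have q0 : (0 < q)%N by rewrite !muln_gt0 d0 m0 D0.
have [res resP] : exists res : F -> 'I_n -> 'I_q.-1.+1, forall x, R x ->
    exists Z : 'rV[int]_n, d%:R *: coordv x = map_mx intr
      (\row_i ((res x i : nat)%:Z + q%:Z * Z 0 i)).
  have [|f fP] := @choice _ _ (fun x (f : 'I_n -> 'I_q.-1.+1) => R x ->
    exists Z : 'rV[int]_n, d%:R *: coordv x = map_mx intr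
      (\row_i ((f i : nat)%:Z + q%:Z * Z 0 i))); last by exists f.
  move=> x; have [Rx|nRx] := pselect (R x); last by exists (fun=> ord0).
  have [Z xZ] := dP x Rx.
  exists (fun i => inord `|modz (Z ord0 i) q%:Z|%N) => _.
  exists (\row_i divz (Z ord0 i) q%:Z); rewrite xZ; apply/rowP => i; rewrite !mxE.
  have qz : q%:Z != 0 by rewrite -lt0n in q0 *; case: (q) q0.
  rewrite inordK; last first.
    rewrite prednK // -ltz_nat gez0_abs ?modz_ge0 //.
    by rewrite ltz_pmod.
  by rewrite gez0_abs ?modz_ge0 // addrC mulrC -divz_eq.
have [rep repP] : exists rep : {ffun 'I_n -> 'I_q.-1.+1} -> F, forall f,
    R (rep f) /\ ((exists2 x, R x & res x =1 f) -> res (rep f) =1 f).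
  have [|r rP] := @choice _ _ (fun (f : {ffun 'I_n -> 'I_q.-1.+1}) y =>
    R y /\ ((exists2 x, R x & res x =1 f) -> res y =1 f)); last by exists r.
  move=> f; have [[x Rx xf]|nf] := pselect (exists2 x, R x & res x =1 f).
    by exists x.
  by exists 0; split; [exact: int0 | move/nf].
exists [seq rep f | f <- enum {: {ffun 'I_n -> 'I_q.-1.+1}}].
split => [y /mapP[f _ ->]|x Rx]; first by have [] := repP f.
pose f := [ffun i => res x i]; exists (rep f).
  by apply: map_f; rewrite mem_enum.
have [Ry yf] := repP f.
have {}yf : res (rep f) =1 res x.
  by move=> i; rewrite yf ?ffunE //; exists x => // j; rewrite ffunE.
have [[Zx xE] [Zy yE]] := (resP x Rx, resP _ Ry).
exists (Zx - Zy).
have dr0 : d%:R != 0 :> rat by rewrite pnatr_eq0 -lt0n.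
apply/coordv_inj/(scalerI dr0).
rewrite linearB scalerBr xE yE mulr_natl raddfMn /= ofcoordK.
apply/rowP => i; rewrite !mxE yf -rmorphB /= opprD addrACA subrr add0r -mulrBr.
by rewrite rmorphM mulmxnE !mxE mulrnAr -mulrnAl -mulrnA.
Qed.

Lemma int_mod_reps (m : nat) : (0 < m)%N ->
  exists s : seq F, (forall y, y \in s -> R y) /\
    forall x, R x -> exists2 y, y \in s & exists2 z, R z & x - y = m%:R * z.
Proof.
move=> m0; have [D D0 [RD H]] := int_mod_finite.
have [s [sR sP]] := H m m0; exists s; split => // x /sP[y ys [Z xy]].
exists y => //; exists (D%:R * ofcoord (map_mx intr Z)); last first.
  by rewrite xy natrM mulrA.
rewrite ofcoord_sum mulr_sumr; elim/big_ind: _ => [|a b|i _]; first exact: int0.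
  exact: intD.
rewrite mxE scaler_int -mulrzr mulrA; apply: intM => //; exact: int_int.
Qed.

(** Coefficients are functions on [nat], to avoid dependent types when spans are
    added. *)
Definition int_span (s : seq F) : set F :=
  [set x | exists c : nat -> int, x = \sum_(i < size s) (c i)%:~R * s`_i].

Lemma int_span_mem s y : y \in s -> int_span s y.
Proof.
move=> ys; exists (fun i => (i == index y s)%:Z).
have ltys : (index y s < size s)%N by rewrite index_mem.
rewrite (bigD1 (Ordinal ltys)) //= eqxx mul1r nth_index // big1 ?addr0 //.
by move=> i; rewrite -val_eqE /= => /negPf->; rewrite mul0r.
Qed.

Lemma int_spanD s x y : int_span s x -> int_span s y -> int_span s (x + y).
Proof.
move=> [c ->] [d ->]; exists (fun i => c i + d i); rewrite -big_split /=.
by apply: eq_bigr => i _; rewrite rmorphD mulrDl.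
Qed.

Lemma int_spanZ s x (k : int) : int_span s x -> int_span s (k%:~R * x).
Proof.
move=> [c ->]; exists (fun i => k * c i); rewrite mulr_sumr /=.
by apply: eq_bigr => i _; rewrite rmorphM mulrA.
Qed.

Lemma int_span_sum s (I : Type) (r : seq I) (E : I -> F) :
  (forall i, int_span s (E i)) -> int_span s (\sum_(i <- r) E i).
Proof.
move=> sE; elim/big_ind: _ => // [|x y]; last exact: int_spanD.
by exists (fun=> 0); rewrite big1 // => i; rewrite mul0r.
Qed.

Lemma int_finitely_generated : exists2 s : seq F,
  (forall y, y \in s -> R y) & forall x, R x -> int_span s x.
Proof.
have [D D0 [RD H]] := int_mod_finite; have [s [sR sP]] := H _ (ltn0Sn 0).
exists (s ++ [seq D%:R * ofcoord (delta_mx 0 i) | i <- enum 'I_n]) => x.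
  by rewrite mem_cat => /orP[/sR|/mapP[i _ ->]].
move=> /sP[y ys [Z /(canRL (subrK _)) ->]]; rewrite mul1n ofcoord_sum mulr_sumr.
apply: int_spanD; last by apply: int_span_mem; rewrite mem_cat ys.
apply: int_span_sum => i; rewrite mxE scaler_int -mulrzl mulrCA.
apply: int_spanZ; apply: int_span_mem; rewrite mem_cat; apply/orP; right.
by apply: map_f; rewrite mem_enum.
Qed.

(** A submodule of [R] containing the positive integer [m] is generated by
    [m R] and the representatives modulo [m R] that it contains. *)
Lemma submodule_finitely_generated (I : set F) (m : nat) :
    submodule I -> I `<=` R -> (0 < m)%N -> I m%:R ->
  exists2 s : seq F, (forall y, y \in s -> I y) & forall x, I x -> int_span s x.
Proof.
move=> [I0 ID IM] IR m0 Im; have [s [sR sP]] := int_mod_reps m0.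
have [g gR gP] := int_finitely_generated.
have ImR z : R z -> I (m%:R * z) by move=> Rz; rewrite mulrC; exact: IM.
exists ([seq y <- s | y \in I] ++ [seq m%:R * z | z <- g]) => x.
  rewrite mem_cat mem_filter => /orP[/andP[/set_mem //]|/mapP[z /gR Rz ->]].
  exact: ImR.
move=> Ix; have [y ys [z Rz xy]] := sP x (IR x Ix).
have Iy : I y.
  rewrite -[y](subKr x) xy; apply: ID => //.
  by rewrite -mulrN; apply: ImR; exact: intN.
rewrite -[x](subrK y) xy; apply: int_spanD; last first.
  by apply: int_span_mem; rewrite mem_cat mem_filter ys andbT; rewrite (mem_set Iy).
have [c ->] := gP z Rz; rewrite mulr_sumr; apply: int_span_sum => i.
rewrite mulrCA; apply: int_spanZ; apply: int_span_mem.
by rewrite mem_cat; apply/orP; right; apply/map_f/mem_nth.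
Qed.

Lemma pos_int_mem (I : set F) x : submodule I -> I `<=` R -> I x -> x != 0 ->
  exists2 m : nat, (0 < m)%N & I m%:R.
Proof.
move=> [_ _ IM] IR Ix x0; have [m m0 Rm] := int_multiple x^-1.
by exists m => //; have := IM _ _ Rm Ix; rewrite mulfVK.
Qed.

(** An ideal containing [m] is determined by the representatives of [R / m R]
    that it contains. *)
Lemma finite_ideals_above (m : nat) : (0 < m)%N ->
  finite_set [set I : set F | [/\ submodule I, I `<=` R & I m%:R]].
Proof.
move=> m0; have [s [sR sP]] := int_mod_reps m0.
pose f (I : set F) : {set 'I_(size s)} := finset (fun i : 'I_(size s) => s`_i \in I).
apply: (@finite_inj _ _ _ f).
suff sub I J : submodule I -> submodule J -> I `<=` R -> I m%:R -> J m%:R ->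
    f I = f J -> I `<=` J.
  move=> I J [sI IR Im] [sJ JR Jm] fIJ.
  by apply/seteqP; split; apply: sub.
move=> [_ ID IM] [_ JD JM] IR Im Jm fIJ x Ix.
have [y ys [z Rz xy]] := sP x (IR x Ix).
have Iy : I y.
  rewrite -[y](subKr x) xy; apply: ID => //.
  by rewrite -mulNr mulrC -mulN1r mulrA; apply: (IM) => //; rewrite mulrN1; exact: intN.
have ltys : (index y s < size s)%N by rewrite index_mem.
have /setP/(_ (Ordinal ltys)) := fIJ; rewrite !inE /= nth_index //.
rewrite (mem_set Iy) => /esym/set_mem Jy.
by rewrite -[x](subrK y) xy; apply: JD => //; rewrite mulrC; exact: JM.
Qed.

End Integers.

(** * Almost Euclidean division *)

(** Among the [k ^ n + 1] vectors of fractional parts of the multiples of [u],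
    two fall into the same one of the [k ^ n] cubes of side [1 / k]. *)
Lemma dirichlet_approx n k (u : 'I_n -> rat) : (0 < k)%N ->
  exists2 t : nat, (0 < t <= k ^ n)%N &
    exists z : 'I_n -> int, forall i, k%:R * `|t%:R * u i - (z i)%:~R| <= 1.
Proof.
case: k => // k _; set K : rat := k.+1%:R.
have K0 : 0 < K by rewrite ltr0n.
pose fr (t : nat) i := t%:R * u i - (Num.floor (t%:R * u i))%:~R.
have fr_itv t i : 0 <= fr t i < 1.
  have := floor_itv (t%:R * u i); rewrite /fr intrD.
  set x := t%:R * u i; set y := (Num.floor x)%:~R => /andP[h1 h2].
  by apply/andP; split; lra.
pose box (t : 'I_(k.+1 ^ n).+1) : {ffun 'I_n -> 'I_k.+1} :=
  [ffun i => inord (Num.truncn (K * fr t i))].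
have boxE t i : (box t i)%:R <= K * fr t i < (box t i).+1%:R.
  have /andP[f0 f1] := fr_itv t i.
  have Kf0 : 0 <= K * fr t i by rewrite mulr_ge0 // ltW.
  have := truncn_itv Kf0; rewrite /box ffunE inordK // truncn_lt_nat //.
  by rewrite -/K; nra.
have [t1 [t2 [lt12 eq12]]] : exists t1 t2 : 'I_(k.+1 ^ n).+1,
    (t1 < t2)%N /\ box t1 = box t2.
  have : ~~ injectiveb box.
    apply/negP => /injectiveP/leq_card.
    by rewrite card_ffun !card_ord ltnn.
  case/injectivePn => t1 [t2 ne eq12].
  have [lt|gt|/val_inj eq] := ltngtP t1 t2; first by exists t1, t2.
    by exists t2, t1.
  by rewrite eq eqxx in ne.
exists (t2 - t1)%N.
  by rewrite subn_gt0 lt12 (leq_trans (leq_subr _ _)) // -ltnS ltn_ord.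
exists (fun i => Num.floor (t2%:R * u i) - Num.floor (t1%:R * u i)) => i.
have /andP[a1 b1] := boxE t1 i; have /andP[a2 b2] := boxE t2 i.
rewrite -eq12 in a2 b2.
have -> : (t2 - t1)%:R * u i - (Num.floor (t2%:R * u i) -
    Num.floor (t1%:R * u i))%:~R = fr t2 i - fr t1 i.
  by rewrite /fr rmorphB natrB 1?ltnW //=; ring.
rewrite -(ger0_norm (ltW K0)) -normrM mulrBr ler_norml.
move: a1 b1 a2 b2; rewrite -!natr1; set c := (box t1 i)%:R => a1 b1 a2 b2.
by apply/andP; split; lra.
Qed.

Lemma det_small m (A : 'M[rat]_m) (e : rat) : (0 < m)%N -> 0 <= e <= 1 ->
  (forall i j, `|A i j| <= e) -> `|\det A| <= m`!%:R * e.
Proof.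
move=> m0 /andP[e0 e1] Ae.
apply: le_trans (ler_norm_sum _ _ _) _.
have -> : m`!%:R * e = \sum_(s : 'S_m) e.
  by rewrite sumr_const card_Sn mulr_natl.
apply: ler_sum => s _; rewrite normrM normrX normrN1 expr1n mul1r normr_prod.
apply: (@le_trans _ _ (\prod_(i < m) e)); first by apply: ler_prod => i _; rewrite normr_ge0 Ae.
by rewrite prodr_const card_ord -{2}[e]expr1 ler_wiXn2l.
Qed.

Section ClassNumber.
Variable F : fieldExtType rat.
Implicit Types x y z : F.
Let R : set F := @int_ring F.
Let n := dim F.

(** The entries of [mulmat x] are linear in the coordinates of [x], so the norm
    is continuous at [0]. *)
Lemma norm_small : exists2 e : rat, 0 < e &
  forall x, (forall i, `|coordv x 0 i| <= e) -> `|norm x| < 1.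
Proof.
pose E i := mulmat (ofcoord (delta_mx 0 i) : F).
pose c : rat := \sum_i \sum_j \sum_k `|E i j k|.
have cE0 : 0 <= c by do 3!apply: sumr_ge0 => ? _; exact: normr_ge0.
pose f : rat := n`!%:R.
have f1 : 1 <= f by rewrite ler1n fact_gt0.
have p0 : 0 < 2 * f * (c + 1) by nra.
(* The bound keeps the entries below 1 and, by the Leibniz formula, the
   determinant below n! times their maximum. *)
exists (2 * f * (c + 1))^-1; first by rewrite invr_gt0.
move=> x; set e := _^-1 => xe.
have eE : e * (2 * f * (c + 1)) = 1 by rewrite mulVf // gt_eqF.
have e0 : 0 < e by rewrite invr_gt0.
have ec : f * (e * c) < 1 by nra.
apply: le_lt_trans ec; apply: det_small.
- exact: dim_gt0.
- by apply/andP; split; nra.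
move=> j k; rewrite -[x]coordvK ofcoord_sum mulmat_sum summxE.
apply: le_trans (ler_norm_sum _ _ _) _; rewrite mulr_sumr.
apply: ler_sum => i _; rewrite mulmatZ mxE normrM ler_pM ?normr_ge0 //.
rewrite (bigD1 j) //= (bigD1 k) //= -addrA lerDl addr_ge0 // !sumr_ge0 // => ? _.
by apply: sumr_ge0.
Qed.

(** Hurwitz's substitute for Euclidean division: up to a multiplier bounded
    independently of the dividend, the remainder is smaller than the divisor. *)
Lemma almost_euclidean : exists2 T : nat, (0 < T)%N &
  forall x, exists2 t : nat, (0 < t <= T)%N &
    exists2 w, R w & `|norm (t%:R * x - w)| < 1.
Proof.
have [D D0 [RD _]] := int_mod_finite F; have [e e0 He] := norm_small.
have Dr0 : D%:R > 0 :> rat by rewrite ltr0n.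
(* Boxes fine enough for the error, at most D / k, to be below e. *)
pose k := (Num.truncn (D%:R / e)).+1.
have kP : D%:R <= k%:R * e.
  by rewrite -ler_pdivrMr // ltW // truncnS_gt.
exists (k ^ n)%N; first by rewrite expn_gt0.
move=> x; have [t tk [z zP]] :=
  dirichlet_approx (fun i => coordv x 0 i / D%:R) (ltn0Sn k.-1).
exists t => //; exists (\sum_i (z i)%:~R * (D%:R * ofcoord (delta_mx 0 i))).
  elim/big_ind: _ => [|a b|i _]; [exact: int0 | exact: intD |].
  by apply: intM (RD i); exact: int_int.
apply: He => i; rewrite linearB linear_sum /= mxE [X in _ + X]mxE summxE.
have -> : t%:R * x = (t%:R : rat) *: x by rewrite scaler_nat mulr_natl.
rewrite linearZ /= mxE (eq_bigr (fun j => (z j)%:~R * D%:R * (j == i)%:R)); last first.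
  move=> j _; have -> : (z j)%:~R * (D%:R * ofcoord (delta_mx 0 j)) =
      ((z j)%:~R * D%:R : rat) *: (ofcoord (delta_mx 0 j) : F).
    by rewrite -scalerA scaler_nat scaler_int mulrzl mulr_natl.
  by rewrite linearZ /= ofcoordK !mxE eqxx eq_sym.
rewrite (bigD1 i) //= big1 ?eqxx ?addr0 ?mulr1 => [|j /negPf->]; last by rewrite mulr0.
have := zP i; set a := coordv x 0 i; set zi := (z i)%:~R.
have -> : t%:R * a - zi * D%:R = D%:R * (t%:R * (a / D%:R) - zi).
  by field; rewrite gt_eqF.
rewrite normrM (ger0_norm (ltW Dr0)) => h.
rewrite -(@ler_pM2l _ k%:R) ?ltr0n // mulrCA.
by apply: le_trans kP; rewrite ger_pMr.
Qed.

End ClassNumber.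

(** * The semiring of submodules *)

Section Submodules.
Variable F : fieldExtType rat.
Implicit Types (x y z : F).
Local Notation R := (@int_ring F).

(** Submodules of [F] over the integers, under sum and product, form a
    commutative semiring, ordered by inclusion; this lets [ring] carry out the
    calculus of ideals. *)
Record submod := Submod { submod_set :> set F; submodP : submodule submod_set }.
(** This second coercion makes [I x] a statement of membership, while [I] itself
    still coerces to a set. *)
Definition submod_mem (I : submod) : F -> Prop := submod_set I.
Coercion submod_mem : submod >-> Funclass.
Implicit Types I J K L : submod.

HB.instance Definition _ := gen_eqMixin submod.
HB.instance Definition _ := gen_choiceMixin submod.

Lemma submod_inj : injective submod_set.
Proof.
move=> [I HI] [J HJ] /= eIJ; subst J; congr Submod; exact: Prop_irrelevance.
Qed.

Lemma submod_eq I J : I `<=` J -> J `<=` I -> I = J.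
Proof. by move=> IJ JI; apply/submod_inj/seteqP. Qed.

Lemma submod0 I : I 0. Proof. by have [] := submodP I. Qed.
Lemma submodD I x y : I x -> I y -> I (x + y).
Proof. by have [_ + _] := submodP I; exact. Qed.
Lemma submodZ I a x : R a -> I x -> I (a * x).
Proof. by have [_ _ +] := submodP I; exact. Qed.
Lemma submodN I x : I x -> I (- x).
Proof. by rewrite -mulN1r; apply: submodZ; exact/intN/int1. Qed.
Lemma submodB I x y : I x -> I y -> I (x - y).
Proof. by move=> Ix /submodN; exact: submodD. Qed.
Lemma ideal_mul_mem (I J : set F) x y : I x -> J y -> ideal_mul I J (x * y).
Proof.
move=> Ix Jy; exists [:: (x, y)]; last by rewrite big_seq1.
by move=> p; rewrite inE => /eqP->.
Qed.

Lemma ideal_mul_sub (I J K : set F) : K 0 -> (forall x y, K x -> K y -> K (x + y)) ->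
  (forall x y, I x -> J y -> K (x * y)) -> ideal_mul I J `<=` K.
Proof.
move=> K0 KD IJK _ [s sIJ ->]; rewrite big_seq.
by elim/big_ind: _ => // p /sIJ[]; exact: IJK.
Qed.

Lemma ideal_mul_submodule (I J : set F) : submodule I -> submodule (ideal_mul I J).
Proof.
move=> [I0 ID IZ]; split.
- by exists [::] => //; rewrite big_nil.
- move=> _ _ [s sP ->] [t tP ->]; exists (s ++ t); last by rewrite big_cat.
  by move=> p; rewrite mem_cat => /orP[/sP|/tP].
- move=> a _ Ra [s sP ->]; exists [seq (a * p.1, p.2) | p <- s].
    by move=> p /mapP[q /sP[Iq Jq] ->] /=; split => //; exact: IZ.
  by rewrite big_map mulr_sumr; apply: eq_bigr => p _; rewrite mulrA.
Qed.

Lemma ideal_add_submodule (I J : set F) :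
  submodule I -> submodule J -> submodule (ideal_add I J).
Proof.
move=> [I0 ID IZ] [J0 JD JZ]; split.
- by exists 0 => //; exists 0 => //; rewrite addr0.
- move=> _ _ [a Ia [b Jb <-]] [c Ic [d Jd <-]].
  by exists (a + c); [exact: ID|exists (b + d); [exact: JD|rewrite addrACA]].
- move=> r _ Rr [a Ia [b Jb <-]].
  by exists (r * a); [exact: IZ|exists (r * b); [exact: JZ|rewrite mulrDr]].
Qed.

Lemma submodule0 : submodule ([set 0] : set F).
Proof.
by split => //= [x y -> ->|a x _ ->]; rewrite ?addr0 ?mulr0.
Qed.

Lemma submodule1 : submodule R.
Proof. by split; [exact: int0 | exact: intD | exact: intM]. Qed.

Definition add_submod I J := Submod (ideal_add_submodule (submodP I) (submodP J)).
Definition mul_submod I J := Submod (@ideal_mul_submodule I J (submodP I)).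

Lemma add_submod_sub I J K : I `<=` K -> J `<=` K -> add_submod I J `<=` K.
Proof. by move=> IK JK _ [x /IK Kx [y /JK Ky <-]]; exact: submodD. Qed.
Lemma add_submodl I J : I `<=` add_submod I J.
Proof. by move=> x Ix; exists x => //; exists 0; [exact: submod0|rewrite addr0]. Qed.
Lemma add_submodr I J : J `<=` add_submod I J.
Proof. by move=> x Ix; exists 0; [exact: submod0|exists x; rewrite ?add0r]. Qed.
Lemma mul_submod_sub I J K : (forall x y, I x -> J y -> K (x * y)) ->
  mul_submod I J `<=` K.
Proof. by apply: ideal_mul_sub; [exact: submod0 | exact: submodD]. Qed.

Fact add_submodA : associative add_submod.
Proof.
have sub := subset_trans.
move=> I J K; apply: submod_eq; do ?apply: add_submod_sub.
- exact: sub (@add_submodl _ _) (@add_submodl _ _).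
- exact: sub (@add_submodr _ _) (@add_submodl _ _).
- exact: add_submodr.
- exact: add_submodl.
- exact: sub (@add_submodl _ _) (@add_submodr _ _).
- exact: sub (@add_submodr _ _) (@add_submodr _ _).
Qed.

Fact add_submodC : commutative add_submod.
Proof.
by move=> I J; apply: submod_eq; apply: add_submod_sub;
  do ?[exact: add_submodl | exact: add_submodr].
Qed.

Fact add0submod : left_id (Submod submodule0) add_submod.
Proof.
move=> I; apply: submod_eq; last exact: add_submodr.
by apply: add_submod_sub => // _ ->; exact: submod0.
Qed.

HB.instance Definition _ :=
  GRing.isNmodule.Build submod add_submodA add_submodC add0submod.

Fact mul_submodC : commutative mul_submod.
Proof.
by move=> I J; apply: submod_eq; apply: mul_submod_sub => x y Ix Jy;
  rewrite mulrC; exact: ideal_mul_mem.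
Qed.

Fact mul_submodA : associative mul_submod.
Proof.
suff sub I J K : mul_submod I (mul_submod J K) `<=` mul_submod (mul_submod I J) K.
  move=> I J K; apply: submod_eq; first exact: sub.
  rewrite (mul_submodC (mul_submod I J)) (mul_submodC I J).
  by rewrite (mul_submodC I) (mul_submodC J K); exact: sub.
apply: mul_submod_sub => x yz Ix; move: yz.
apply: (@ideal_mul_sub _ _ [set yz | mul_submod (mul_submod I J) K (x * yz)]).
- by rewrite /mkset mulr0; exact: submod0.
- by move=> y z; rewrite /mkset mulrDr; exact: submodD.
by move=> y z Jy Kz; rewrite /mkset mulrA; do 2!apply: ideal_mul_mem => //.
Qed.

Fact mul1submod : left_id (Submod submodule1) mul_submod.
Proof.
move=> I; apply: submod_eq; first by apply: mul_submod_sub => *; exact: submodZ.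
by move=> x Ix; rewrite -[x]mul1r; apply: ideal_mul_mem => //; exact: int1.
Qed.

Fact mul_submodDl : left_distributive mul_submod add_submod.
Proof.
move=> I J K; apply: submod_eq.
  apply: mul_submod_sub => _ z [x Ix [y Jy <-]] Kz; rewrite mulrDl.
  exists (x * z); first exact: ideal_mul_mem.
  by exists (y * z); first exact: ideal_mul_mem.
apply: add_submod_sub; apply: mul_submod_sub => x z Ix Kz;
  apply: ideal_mul_mem => //; [exact: add_submodl|exact: add_submodr].
Qed.

Fact mul0submod : left_zero (Submod submodule0) mul_submod.
Proof.
move=> I; apply: submod_eq => [|_ ->]; last exact: (submod0 (mul_submod _ _)).
by apply: mul_submod_sub => _ y -> _; rewrite mul0r.
Qed.

HB.instance Definition _ := GRing.Nmodule_isComPzSemiRing.Build submod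
  mul_submodA mul_submodC mul1submod mul_submodDl mul0submod.

Lemma mem_mul I J x y : I x -> J y -> (I * J)%R (x * y).
Proof. exact: ideal_mul_mem. Qed.
Lemma mul_sub I J K : (forall x y, I x -> J y -> K (x * y)) -> I * J `<=` K.
Proof. exact: mul_submod_sub. Qed.
Lemma add_sub I J K : I `<=` K -> J `<=` K -> I + J `<=` K.
Proof. exact: add_submod_sub. Qed.
Lemma addl_sub I J : I `<=` I + J. Proof. exact: add_submodl. Qed.
Lemma addr_sub I J : J `<=` I + J. Proof. exact: add_submodr. Qed.
Lemma add_mono I J K L : I `<=` J -> K `<=` L -> I + K `<=` J + L.
Proof.
move=> IJ KL; apply: add_sub.
  exact: subset_trans IJ (@addl_sub _ _).
exact: subset_trans KL (@addr_sub _ _).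
Qed.
Lemma mul_mono I J K L : I `<=` J -> K `<=` L -> I * K `<=` J * L.
Proof. by move=> IJ KL; apply: mul_sub => x y /IJ Jx /KL Ly; exact: mem_mul. Qed.
Lemma mul_int_sub I J : J `<=` (1 : submod) -> I * J `<=` I.
Proof. by move=> J1; rewrite -[X in _ `<=` submod_set X]mulr1; exact: mul_mono. Qed.
Lemma principal_submodule x : submodule [set a * x | a in R].
Proof.
split; first by exists 0; [exact: int0 | rewrite mul0r].
- move=> _ _ [a Ra <-] [b Rb <-]; exists (a + b); last by rewrite mulrDl.
  exact: intD.
- by move=> c _ Rc [a Ra <-]; exists (c * a); [exact: intM|rewrite mulrA].
Qed.
Definition principal x := Submod (principal_submodule x).

Lemma mem_principal x : principal x x.
Proof. by exists 1; [exact: int1 | rewrite mul1r]. Qed.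
Lemma principal_sub x I : principal x `<=` I <-> I x.
Proof.
split=> [|Ix _ [a Ra <-]]; last exact: submodZ.
by apply; exact: mem_principal.
Qed.
Lemma principalM x y : principal (x * y) = principal x * principal y.
Proof.
apply: submod_eq; first by apply/principal_sub/mem_mul; exact: mem_principal.
apply: mul_sub => _ _ [a Ra <-] [b Rb <-].
by exists (a * b); [exact: intM | rewrite mulrACA].
Qed.
Lemma principal1 : principal 1 = 1.
Proof.
by apply: submod_eq; [apply/principal_sub; exact: int1|move=> x Rx; exists x; rewrite ?mulr1].
Qed.
Lemma principalV x : x != 0 -> principal x * principal x^-1 = 1.
Proof. by move=> x0; rewrite -principalM mulfV // principal1. Qed.
Lemma mem_principal_mul x I y : (principal x * I)%R y <-> exists2 z, I z & y = x * z.
Proof.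
split=> [|[z Iz ->]]; last by apply: mem_mul => //; exact: mem_principal.
move: y; apply: ideal_mul_sub => [|_ _ [a Ia ->] [b Ib ->]|_ z [a Ra <-] Iz].
- by exists 0; [exact: submod0|rewrite mulr0].
- by exists (a + b); [exact: submodD|rewrite mulrDr].
- by exists (a * z); [exact: submodZ|rewrite mulrAC mulrC mulrA; ring].
Qed.
Lemma ideal_scaleE x I : ideal_scale x I = principal x * I.
Proof.
by apply/seteqP; split => y => [[z Iz <-]|/mem_principal_mul[z Iz ->]];
  [apply/mem_principal_mul|]; exists z.
Qed.

Lemma ideal_inv_submodule (I : set F) : submodule (ideal_inv I).
Proof.
split=> [y _|x y Ix Iy z Iz|a x Ra Ix y Iy]; first by rewrite mul0r; exact: int0.
  by rewrite mulrDl; apply: intD; [exact: Ix|exact: Iy].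
by rewrite -mulrA; apply: intM => //; exact: Ix.
Qed.
Definition inverse I := Submod (@ideal_inv_submodule I).

(** Multiplying [inverse I * I `<=` 1] by [J] gives [inverse I `<=` J], and the
    converse inclusion is the definition of [inverse I]. *)
Lemma inverseE I J : I * J = 1 -> inverse I = J.
Proof.
move=> IJ; have invI : inverse I * I `<=` (1 : submod).
  by apply: mul_sub => x y; exact.
apply: submod_eq; last first.
  by move=> x Jx y Iy; have := mem_mul Iy Jx; rewrite IJ [y * x]mulrC.
have -> : inverse I = inverse I * I * J by rewrite -mulrA IJ mulr1.
by rewrite -[X in _ `<=` submod_set X]mul1r; exact: mul_mono.
Qed.

Lemma invertible_neq0 I J : I * J = 1 -> exists2 x, I x & x != 0.
Proof.
move=> IJ; apply: contrapT => nx; have : (1 : submod) 1 by exact: int1.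
rewrite -IJ; suff sub : I * J `<=` (0 : submod).
  by move/sub => /eqP; rewrite oner_eq0.
apply: mul_sub => x y Ix _; have [->|x0] := eqVneq x 0; last by case: nx; exists x.
by rewrite mul0r.
Qed.

Lemma invertibleM I J : I * inverse I = 1 -> J * inverse J = 1 ->
  (I * J) * inverse (I * J) = 1.
Proof.
move=> I1 J1; have E : (I * J) * (inverse I * inverse J) = 1.
  by transitivity ((I * inverse I) * (J * inverse J)); [ring|rewrite I1 J1 mul1r].
by rewrite (inverseE E).
Qed.

Lemma cancel_sub I J K : I * inverse I = 1 -> I * J `<=` I * K -> J `<=` K.
Proof.
move=> I1 IJK; rewrite -[J]mul1r -[K]mul1r -I1 [I * _]mulrC -!mulrA.
by apply: mul_mono.
Qed.

End Submodules.

Arguments submod_mem : simpl never.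
Arguments mul_submod : simpl never.
Arguments add_submod : simpl never.
Arguments principal : simpl never.
Arguments inverse : simpl never.

(** * Invertibility of fractional ideals *)

Section Invertibility.
Variable F : fieldExtType rat.
Implicit Types (x y z : F) (I J K A B : submod F).
Local Notation R := (@int_ring F).

Lemma natF_neq0 (m : nat) : (0 < m)%N -> m%:R != 0 :> F.
Proof.
move=> m0; have -> : (m%:R : F) = (m%:R : rat) *: 1 by rewrite scaler_nat.
by rewrite scaler_eq0 oner_eq0 orbF pnatr_eq0 -lt0n.
Qed.

(** Scaling by [T`! / y], with [y] a nonzero element of least norm, makes every
    ideal integral while containing the fixed integer [T`!]. *)
Lemma bounded_class_rep : exists2 m : nat, (0 < m)%N &
  forall I, frac_ideal I -> exists2 x, x != 0 &
    principal x * I `<=` (1 : submod F) /\ (principal x * I)%R m%:R.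
Proof.
have F0 := natF_neq0.
have [T T0 TP] := almost_euclidean F.
exists T`!; first exact: fact_gt0.
move=> I [_ [y0 Iy0 y00] [d [d0 Rd dI]]].
pose P (k : nat) := `[< exists y, [/\ I y, y != 0 & `|norm (d * y)| = k%:R] >].
have exP : exists k, P k.
  have /natr_norm_int/natrP[k kE] := norm_int (dI _ Iy0).
  by exists k; apply/asboolP; exists y0.
have [k /asboolP[y [Iy y1 yk]] kmin] := ex_minnP exP.
have Iy' : I y := Iy.
exists (T`!%:R / y); first by rewrite mulf_neq0 ?invr_eq0 // F0 // fact_gt0.
split; last by apply/mem_principal_mul; exists y; rewrite // mulfVK.
move=> _ /mem_principal_mul[z Iz ->].
have [t /andP[t0 tT] [w Rw tw]] := TP (z / y).
have Ia : I (t%:R * z - w * y) by apply: submodB; apply: submodZ => //; exact: int_nat.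
have a0 : t%:R * z - w * y = 0.
  apply/eqP; apply: contraPT tw => a0; apply/negP; rewrite -leNgt.
  have aE : d * (t%:R * z - w * y) = (t%:R * (z / y) - w) * (d * y) by field.
  have /natr_norm_int/natrP[l lE] := norm_int (dI _ Ia).
  have : P l by apply/asboolP; exists (t%:R * z - w * y).
  move/kmin; rewrite -(ler_nat rat) -lE aE normM normrM -yk -[leLHS]mul1r.
  by rewrite ler_pM2r // normr_gt0 norm_eq0 mulf_neq0.
have -> : T`!%:R / y * z = (T`! %/ t)%:R * w.
  have t0F := F0 t t0.
  have -> : (T`!%:R : F) = (T`! %/ t)%:R * t%:R.
    by rewrite -natrM divnK // dvdn_fact // t0.
  have -> : z = w * y / t%:R.
    by apply: (canRL (mulfK t0F)); rewrite mulrC; apply/eqP; rewrite -subr_eq0 a0.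
  by field; rewrite y1 t0F.
by apply: intM => //; exact: int_nat.
Qed.

(** A multiple of a fractional ideal is an integral ideal, to which
    [submodule_finitely_generated] applies. *)
Lemma frac_generators I : frac_ideal I -> exists s : seq F,
  [/\ forall y, y \in s -> I y, exists2 y, y \in s & y != 0
    & forall x, I x -> int_span s x].
Proof.
move=> [_ [y0 Iy0 y00] [d [d0 Rd dI]]].
have J1 : principal d * I `<=` (1 : submod F).
  by move=> _ /mem_principal_mul[z Iz ->]; exact: dI.
have Jy : (principal d * I)%R (d * y0) by apply/mem_principal_mul; exists y0.
have [m m0 Jm] := pos_int_mem (submodP _) J1 Jy (mulf_neq0 d0 y00).
have [s sJ sP] := submodule_finitely_generated (submodP _) J1 m0 Jm.
have span x : I x -> int_span [seq d^-1 * z | z <- s] x.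
  move=> Ix; have dx : (principal d * I)%R (d * x).
    by apply/mem_principal_mul; exists x.
  have [c dxE] := sP _ dx; rewrite -[x](mulKf d0) dxE mulr_sumr.
  apply: int_span_sum => i; rewrite mulrCA; apply: int_spanZ.
  by apply: int_span_mem; apply/map_f/mem_nth.
exists [seq d^-1 * z | z <- s]; split => //.
  by move=> _ /mapP[z /sJ/mem_principal_mul[x Ix ->] ->]; rewrite mulKf.
apply: contrapT => s0; move/negP: y00; apply; apply/eqP.
have [c ->] := span _ Iy0; rewrite big1 // => i _.
have [->|ne] := eqVneq ([seq d^-1 * z | z <- s]`_i) 0; first by rewrite mulr0.
by case: s0; exists [seq d^-1 * z | z <- s]`_i => //; exact: mem_nth.
Qed.

(** On generators of [I], multiplication by [x] is given by an integer matrix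
    having [x] as eigenvalue. *)
Lemma multiplier_int I x : frac_ideal I -> (forall y, I y -> I (x * y)) -> R x.
Proof.
move=> fI xI; have [s [sI [y ys y0] span]] := frac_generators fI.
pose v : 'rV[F]_(size s) := \row_i s`_i.
have [c cP] : exists c : 'I_(size s) -> nat -> int, forall j : 'I_(size s),
    x * s`_j = \sum_(i < size s) (c j i)%:~R * s`_i.
  have [|c cP] := @choice _ _ (fun (j : 'I_(size s)) (c : nat -> int) =>
    x * s`_j = \sum_(i < size s) (c i)%:~R * s`_i); last by exists c.
  by move=> j; have [c cE] := span _ (xI _ (sI _ (mem_nth 0 (ltn_ord j)))); exists c.
apply: (@int_eigenvalue _ _ (\matrix_(i < size s, j < size s) c j i) v).
  have ltys : (index y s < size s)%N by rewrite index_mem.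
  apply/eqP => /rowP/(_ (Ordinal ltys)); rewrite !mxE /= nth_index //.
  exact/eqP.
apply/rowP => j; rewrite !mxE cP; apply: eq_bigr => i _; rewrite !mxE.
by rewrite mulrC.
Qed.

(** Nakayama's lemma: if [M] is the matrix over [B] expressing generators of
    [A] in terms of themselves, then [det (1 - M)] is zero and lies in [1 + B]. *)
Lemma nakayama A B : frac_ideal A -> B `<=` (1 : submod F) -> A `<=` B * A ->
  B = 1.
Proof.
move=> fA B1 ABA; have [s [sA [y ys y0] span]] := frac_generators fA.
have combo x : (B * A)%R x -> exists b : nat -> F,
    (forall i, B (b i)) /\ x = \sum_(i < size s) b i * s`_i.
  move: x; apply: ideal_mul_sub.
  - exists (fun=> 0); split => [i|]; first exact: submod0.
    by rewrite big1 // => i; rewrite mul0r.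
  - move=> _ _ [b [Bb ->]] [c [Bc ->]]; exists (fun i => b i + c i).
    split => [i|]; first exact: submodD.
    by rewrite -big_split; apply: eq_bigr => i _; rewrite mulrDl.
  - move=> b x Bb /span[c ->]; exists (fun i => (c i)%:~R * b).
    split => [i|]; first by apply: submodZ => //; exact: int_int.
    by rewrite mulr_sumr; apply: eq_bigr => i _; rewrite mulrCA mulrA.
have [b bP] : exists b : 'I_(size s) -> nat -> F, forall j : 'I_(size s),
    (forall i, B (b j i)) /\ s`_j = \sum_(i < size s) b j i * s`_i.
  have [|b bP] := @choice _ _ (fun (j : 'I_(size s)) (b : nat -> F) =>
    (forall i, B (b i)) /\ s`_j = \sum_(i < size s) b i * s`_i); last by exists b.
  by move=> j; apply/combo/ABA/sA/mem_nth.
pose M : 'M[F]_(size s) := \matrix_(i < size s, j < size s) b j i.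
pose v : 'rV[F]_(size s) := \row_i s`_i.
have v0 : v != 0.
  have ltys : (index y s < size s)%N by rewrite index_mem.
  apply/eqP => /rowP/(_ (Ordinal ltys)); rewrite !mxE /= nth_index //.
  exact/eqP.
have det0 : \det (1%:M - M) = 0.
  apply/eqP/det0P; exists v => //; apply/eqP; rewrite mulmxBr mulmx1 subr_eq0.
  apply/eqP/rowP => j; rewrite !mxE; have [_ ->] := bP j.
  by apply: eq_bigr => i _; rewrite !mxE mulrC.
(* Determinants are congruent modulo B when the matrices are. *)
pose cong (x z : F) := [/\ R x, R z & B (x - z)].
have congD x z x' z' : cong x z -> cong x' z' -> cong (x + x') (z + z').
  move=> [Rx Rz xz] [Rx' Rz' xz']; split; [exact: intD|exact: intD|].
  by rewrite opprD addrACA; exact: submodD.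
have congM x z x' z' : cong x z -> cong x' z' -> cong (x * x') (z * z').
  move=> [Rx Rz xz] [Rx' Rz' xz']; split; [exact: intM|exact: intM|].
  have -> : x * x' - z * z' = x' * (x - z) + z * (x' - z') by ring.
  by apply: submodD; apply: submodZ.
have congR x : R x -> cong x x by move=> Rx; split => //; rewrite subrr; exact: submod0.
have : cong (\det (1%:M - M)) (\det (1%:M : 'M[F]_(size s))).
  rewrite /determinant; elim/big_rec2: _ => [|g y1 y2 _ IH]; first exact/congR/int0.
  apply: congD IH; apply: (congM); first by apply/congR/intX/intN/int1.
  elim/big_rec2: _ => [|i y1' y2' _ IH]; first exact/congR/int1.
  apply: congM IH; have R1 : R (1%:M i (g i)) by rewrite mxE; exact: int_nat.
  have BM : B (M i (g i)) by rewrite mxE; have [+ _] := bP (g i).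
  rewrite mxE [(- M) _ _]mxE; split => //; first by apply: intB => //; exact: B1.
  by rewrite addrAC subrr add0r; exact: submodN.
rewrite det0 det1 => -[_ _]; rewrite sub0r => B1'.
apply: submod_eq => // x Rx; rewrite -[x]mulr1 -[1]opprK; apply: submodZ => //.
exact: submodN.
Qed.

Lemma integral_bounded_finite (m : nat) : (0 < m)%N ->
  finite_set [set I : submod F | I `<=` (1 : submod F) /\ I m%:R].
Proof.
move=> m0; have fin := finite_ideals_above F m0.
set S := [set I : submod F | _].
rewrite -(@eq_finite_set _ _ ((@submod_set F) @` S)); last first.
  by apply: inj_card_eq => I J _ _; exact: submod_inj.
by apply: sub_finite_set fin => _ [I [I1 Im] <-]; split => //; exact: submodP.
Qed.

Lemma nat_pigeonhole (T : Type) (S : set T) (f : nat -> T) :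
  finite_set S -> (forall i, S (f i)) -> exists i j, (i < j)%N /\ f i = f j.
Proof.
move=> fS Sf; apply: contrapT => nij; apply: infinite_nat.
have fim : finite_set (range f) by apply: sub_finite_set fS => _ [i _ <-].
rewrite -(@eq_finite_set _ _ (range f)) //; apply: inj_card_eq => i j _ _ fij.
have [lt|lt|//] := ltngtP i j; case: nij; first by exists i, j.
by exists j, i.
Qed.

Lemma frac_mul I J : frac_ideal I -> frac_ideal J -> frac_ideal (I * J)%R.
Proof.
move=> [_ [x Ix x0] [d [d0 Rd dI]]] [_ [y Jy y0] [e [e0 Re eJ]]]; split.
- exact: submodP.
- by exists (x * y); [exact: mem_mul|exact: mulf_neq0].
exists (d * e); split; [exact: mulf_neq0|exact: intM|].
have sub : principal (d * e) * (I * J) `<=` (1 : submod F).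
  have -> : principal (d * e) * (I * J) = (principal d * I) * (principal e * J).
    by rewrite principalM; ring.
  rewrite -[X in _ `<=` submod_set X]mulr1; apply: mul_mono.
    by move=> _ /mem_principal_mul[z Iz ->]; exact: dI.
  by move=> _ /mem_principal_mul[z Iz ->]; exact: eJ.
by move=> z IJz; apply: sub; apply/mem_principal_mul; exists z.
Qed.

Lemma frac_principal x : x != 0 -> frac_ideal (principal x).
Proof.
move=> x0; split; [exact: submodP|exists x => //; exact: mem_principal|].
have [m m0 Rm] := int_multiple x.
exists m%:R; split; [exact: natF_neq0|exact: int_nat|].
by move=> _ [a Ra <-]; rewrite mulrCA; exact: intM.
Qed.

Lemma frac1 : frac_ideal (1 : submod F).
Proof. by rewrite -principal1; exact/frac_principal/oner_neq0. Qed.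

Lemma fracX I k : frac_ideal I -> frac_ideal (I ^+ k)%R.
Proof.
by move=> fI; elim: k => [|k IH]; [exact: frac1|rewrite exprS; exact: frac_mul].
Qed.

(** Two powers of [I] lie in the same class by finiteness, say
    [I ^+ j = x I ^+ i]; cancelling [I ^+ i] exhibits an inverse of [I]. *)
Lemma frac_invertible I : frac_ideal I -> I * inverse I = 1.
Proof.
move=> fI; have [m m0 mP] := bounded_class_rep.
have [x xP] : exists x : nat -> F, forall i, x i != 0 /\
    [set J : submod F | J `<=` (1 : submod F) /\ J m%:R] (principal (x i) * I ^+ i).
  have [|x xP] := @choice _ _ (fun i (x : F) => x != 0 /\
    [set J : submod F | J `<=` (1 : submod F) /\ J m%:R] (principal x * I ^+ i)).
    by move=> i; have [x x0 xI] := mP _ (fracX i fI); exists x.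
  by exists x.
have [i [j [ltij Eij]]] := nat_pigeonhole (f := fun i => principal (x i) * I ^+ i)
  (integral_bounded_finite m0) (fun i => (xP i).2).
have [[xi0 _] [xj0 _]] := (xP i, xP j).
(* B fixes I ^+ i, hence is the unit ideal. *)
pose B := principal (x j / x i) * I ^+ (j - i).
have BI : B * I ^+ i = I ^+ i.
  rewrite /B -mulrA -exprD subnK 1?ltnW // principalM mulrAC -Eij mulrAC.
  by rewrite -principalM mulfV // principal1 mul1r.
have B1 : B = 1.
  apply: nakayama (fracX i fI) _ _; last by rewrite BI.
  move=> b Bb; apply: multiplier_int (fracX i fI) _ => y Iy.
  by rewrite -BI; exact: mem_mul.
have E : I * (principal (x j / x i) * I ^+ (j - i).-1) = 1.
  by rewrite mulrCA -exprS prednK ?subn_gt0.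
by rewrite (inverseE E).
Qed.

Lemma frac_inverse I : I * inverse I = 1 -> frac_ideal (inverse I).
Proof.
move=> I1; have [x Ix x0] := invertible_neq0 I1.
rewrite mulrC in I1; have [y Iy y0] := invertible_neq0 I1.
have [m m0 Rm] := int_multiple x.
split; [exact: submodP|by exists y|exists (m%:R * x); split=> //].
  by rewrite mulf_neq0 ?natF_neq0.
by move=> z Iz; rewrite -mulrA; apply: intM; [exact: int_nat|rewrite mulrC; exact: Iz].
Qed.

End Invertibility.

(** * Approximation modulo ideals *)

Section Approximation.
Variable F : fieldExtType rat.
Implicit Types (x y z : F) (A B D E G I J K P Q : submod F).
Local Notation R := (@int_ring F).
Local Notation one := (1 : submod F).

Definition maximal P : Prop :=
  [/\ P `<=` one, P <> 1 & forall J, P `<=` J -> J `<=` one -> J = P \/ J = 1].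

(** If every proper ideal above [G] could be enlarged to another one, iterating
    would give infinitely many ideals containing [m]. *)
Lemma exists_maximal G (m : nat) : (0 < m)%N -> G m%:R -> G `<=` one -> G <> 1 ->
  exists2 P, maximal P & G `<=` P.
Proof.
move=> m0 Gm G1 nG1; apply: contrapT => noP.
pose ok J := [/\ G `<=` J, J `<=` one & J <> 1].
have next J : ok J -> exists J', [/\ ok J', J `<=` J' & J' <> J].
  move=> [GJ J1 nJ1]; apply: contrapT => nJ; apply: noP; exists J => //.
  split=> // K JK K1; have [->|nKJ] := pselect (K = J); first by left.
  have [->|nK1] := pselect (K = 1); first by right.
  by case: nJ; exists K; split=> //; split=> //; exact: subset_trans JK.
have [f fP] : exists f : submod F -> submod F,
    forall J, ok J -> [/\ ok (f J), J `<=` f J & f J <> J].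
  have [|f fP] := @choice _ _ (fun J J' => ok J -> [/\ ok J', J `<=` J' & J' <> J]).
    move=> J; have [/next[J' HJ']|nJ] := pselect (ok J); first by exists J'.
    by exists J.
  by exists f.
pose c i := iter i f G.
have okc i : ok (c i).
  elim: i => [|i IH]; first by split.
  by have [] := fP _ IH.
have [|i [j [ltij Eij]]] := nat_pigeonhole (f := c) (integral_bounded_finite F m0).
  by move=> i; have [GJ J1 _] := okc i; split=> //; exact: GJ.
have up k : c i.+1 `<=` c (k + i.+1)%N.
  by elim: k => // k IH; apply: subset_trans IH _; have [] := fP _ (okc (k + i.+1)%N).
have [_ sub ne] := fP _ (okc i); apply: ne; apply: submod_eq => //.
by have := up (j - i.+1)%N; rewrite subnK // -Eij.
Qed.

Lemma maximal_coprime P A : maximal P -> A `<=` one -> ~ A `<=` P -> A + P = 1.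
Proof.
move=> [P1 _ maxP] A1 nAP.
have [E|//] := maxP (A + P) (@addr_sub _ _ _) (add_sub A1 P1).
by case: nAP; rewrite -E; exact: addl_sub.
Qed.

(** If [A] is not contained in [P], then [B = (A + P) B] is. *)
Lemma maximal_prime P A B : maximal P -> A `<=` one -> B `<=` one ->
  A * B `<=` P -> A `<=` P \/ B `<=` P.
Proof.
move=> maxP A1 B1 ABP; have [|nAP] := pselect (A `<=` P); first by left.
right; rewrite -[B]mul1r -(maximal_coprime maxP A1 nAP) mulrDl.
by apply: add_sub => //; exact: mul_int_sub.
Qed.

(** The maximal ideals are treated one by one: if the current element lies in
    [P I], it is corrected by an element outside [P I] that lies in [Q I] for all
    the other ideals [Q] of the list. *)
Lemma avoid_maximals (s : seq (submod F)) I D z :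
    I * inverse I = 1 -> D `<=` one -> uniq s ->
    (forall P, P \in s -> maximal P /\ ~ D `<=` P) ->
  exists2 w, (I * D)%R w & forall P, P \in s -> ~ (P * I)%R (z + w).
Proof.
move=> I1 D1; elim: s => [|P s IH] /=; first by exists 0 => //; exact: submod0.
move=> /andP[Ps us] HP.
have [|w IDw nw] := IH us; first by move=> Q Qs; apply: HP; rewrite inE Qs orbT.
have [maxP nDP] := HP P (mem_head _ _).
have [Pw|nPw] := pselect ((P * I)%R (z + w)); last first.
  by exists w => // Q; rewrite inE => /predU1P[->|/nw].
pose M : submod F := \prod_(Q <- s) Q.
have s1 Q : Q \in s -> Q `<=` one.
  by move=> Qs; have [[]] := HP Q (mem_behead (s := P :: s) Qs).
have M1 t : {subset t <= s} -> \prod_(Q <- t) Q `<=` one.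
  elim: t => [|Q t IHt] ts; first by rewrite big_nil.
  rewrite big_cons; apply: subset_trans (s1 Q (ts _ (mem_head _ _))).
  by apply/mul_int_sub/IHt => K Kt; apply: ts; rewrite inE Kt orbT.
have [v [IDMv nPv]] : exists v, (I * (D * M))%R v /\ ~ (P * I)%R v.
  apply: contrapT => nv.
  have sub : I * (D * M) `<=` I * P.
    move=> v IDMv; apply: contrapT => nPv; apply: nv; exists v.
    by rewrite [P * I]mulrC.
  have [//|] := maximal_prime maxP D1 (M1 s (fun _ => id)) (cancel_sub I1 sub).
  suff nt t : {subset t <= s} -> ~ \prod_(Q <- t) Q `<=` P by exact: nt.
  elim: t => [|Q t IHt] ts.
    rewrite big_nil => P1; have [P1' nP1 _] := maxP; apply: nP1.
    exact: submod_eq.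
  rewrite big_cons => QtP.
  have ts' : {subset t <= s} by move=> K Kt; apply: ts; rewrite inE Kt orbT.
  have Qs := ts Q (mem_head _ _).
  have [QP|] := maximal_prime maxP (s1 Q Qs) (M1 t ts') QtP; last exact: IHt.
  have [[_ _ maxQ] _] := HP Q (mem_behead (s := P :: s) Qs).
  have [P1 nP1 _] := maxP.
  by have [PQ|//] := maxQ P QP P1; rewrite PQ Qs in Ps.
exists (w + v).
  apply: submodD => //; move: v IDMv {nPv}; rewrite mulrA.
  exact/mul_int_sub/M1.
move=> Q; rewrite inE addrA => /predU1P[->|Qs].
  by move=> Pwv; apply: nPv; rewrite -[v](addKr (z + w)) addrC; exact: submodB.
move=> Qwv; apply: (nw Q Qs); rewrite -[z + w](addrK v); apply: submodB => //.
move: v IDMv {nPv Qwv}; rewrite /M (big_rem Q Qs) /=.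
have -> : I * (D * (Q * \prod_(K <- rem Q s) K)) =
    (Q * I) * (D * \prod_(K <- rem Q s) K) by ring.
apply/mul_int_sub; apply: subset_trans D1; apply/mul_int_sub/M1.
by move=> K; exact: mem_rem.
Qed.

(** An element generates [I] modulo [I E] if it avoids [P I] for every maximal
    ideal [P] above [E].  When [P] contains [D] this holds for all elements of
    [z + I D], and [avoid_maximals] finds one that deals with the others. *)
Lemma approximation I D E z (m : nat) :
    I * inverse I = 1 -> (0 < m)%N -> E m%:R -> E `<=` D -> D `<=` one ->
    principal z + I * D = I ->
  exists z', [/\ z' != 0, (I * D)%R (z' - z) & principal z' + I * E = I].
Proof.
move=> I1 m0 Em ED D1 zI.
have fin : finite_set [set P : submod F | [/\ maximal P, E `<=` P & ~ D `<=` P]].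
  apply: sub_finite_set (integral_bounded_finite F m0) => P [[P1 _ _] EP _].
  by split=> //; exact: EP.
have [||w IDw nw] := @avoid_maximals
    (fset_set [set P : submod F | [/\ maximal P, E `<=` P & ~ D `<=` P]]) I D z I1 D1.
- exact: fset_uniq.
- by move=> P; rewrite in_fset_set // => /set_mem[].
have E1 : E `<=` one by exact: subset_trans D1.
have IDI : I * D `<=` I by exact: mul_int_sub.
have Iz : I z by rewrite -zI; apply: addl_sub; exact: mem_principal.
have Izw : I (z + w) by apply: submodD => //; exact: IDI.
have gen : principal (z + w) + I * E = I.
  apply: submod_eq; first by apply: add_sub; [exact/principal_sub|exact: mul_int_sub].
  set J := principal (z + w) + I * E.
  have JI : J = J * inverse I * I by rewrite -mulrA [inverse I * I]mulrC I1 mulr1.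
  have JG : J * inverse I `<=` one.
    rewrite -I1; apply: mul_mono => //; apply: add_sub; last exact: mul_int_sub.
    exact/principal_sub.
  suff G1 : J * inverse I = 1 by rewrite [J]JI G1 mul1r.
  apply: contrapT => nG1.
  have EG : E `<=` J * inverse I.
    rewrite -[E]mulr1 -I1 mulrA [E * I]mulrC; apply: mul_mono => //.
    exact: addr_sub.
  have [P maxP GP] := exists_maximal m0 (EG _ Em) JG nG1.
  have Pzw : (P * I)%R (z + w).
    have : J (z + w) by apply: addl_sub; exact: mem_principal.
    by rewrite JI; apply: mul_mono.
  have [DP|nDP] := pselect (D `<=` P).
    have [P1 nP1 _] := maxP; apply: nP1; apply: submod_eq => //.
    apply: (cancel_sub I1); rewrite mulr1 -[X in submod_set X `<=` _]zI.
    apply: add_sub; last exact: mul_mono.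
    apply/principal_sub; rewrite -[z](addrK w); apply: submodB.
      by rewrite mulrC.
    by move: w IDw {nw Izw J JI JG nG1 EG GP Pzw}; exact: mul_mono.
  apply: (nw P) => //; rewrite in_fset_set //; apply/mem_set; split=> //.
  exact: subset_trans GP.
(* If the element found is 0, then I E = I and any nonzero element of I will do. *)
have [zw0|zw0] := eqVneq (z + w) 0; last first.
  by exists (z + w); split=> //; rewrite addrC addKr.
have IEI : I * E = I.
  by apply: submod_eq; [exact: mul_int_sub|rewrite -{1}gen zw0; apply: add_sub => //;
    apply/principal_sub; exact: submod0].
have [x Ix x0] := invertible_neq0 I1.
exists x; split=> //.
  have -> : x - z = x + w by rewrite -[w](addKr z) zw0 addr0.
  apply: submodD => //; rewrite -IEI in Ix; move: x Ix {x0}; exact: mul_mono.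
rewrite IEI; apply: submod_eq; last exact: addr_sub.
by apply: add_sub => //; exact/principal_sub.
Qed.

End Approximation.

(** * Finiteness of the class groups *)

Section ClassNumbers.
Variable F : fieldExtType rat.
Implicit Types (x y z : F).
Local Notation R := (@int_ring F).

Lemma frac_submod (I : set F) : frac_ideal I -> exists J : submod F, J = I :> set F.
Proof. by move=> [sI _ _]; exists (Submod sI). Qed.

Lemma class_rel_refl (I : set F) : class_rel I I.
Proof.
exists 1; first exact: oner_neq0.
by apply/seteqP; split=> [x Ix|_ [y Iy <-]]; rewrite ?mul1r //; exists x; rewrite ?mul1r.
Qed.

Lemma ideal_scaleM x y (I : set F) :
  ideal_scale x (ideal_scale y I) = ideal_scale (x * y) I.
Proof.
apply/seteqP; split=> [_ [_ [z Iz <-] <-]|_ [z Iz <-]].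
  by exists z; rewrite ?mulrA.
by exists (y * z); [exists z|rewrite mulrA].
Qed.

Lemma ideal_scale1 (I : set F) : ideal_scale 1 I = I.
Proof.
by apply/seteqP; split=> [_ [z Iz <-]|z Iz]; [rewrite mul1r|exists z; rewrite ?mul1r].
Qed.

Lemma class_rel_sym (I J : set F) : class_rel I J -> class_rel J I.
Proof.
move=> [x x0 ->]; exists x^-1; first by rewrite invr_eq0.
by rewrite ideal_scaleM mulVf // ideal_scale1.
Qed.

Lemma class_rel_trans (I J K : set F) : class_rel I J -> class_rel J K -> class_rel I K.
Proof.
move=> [x x0 ->] [y y0 ->]; exists (y * x); first exact: mulf_neq0.
by rewrite ideal_scaleM.
Qed.

Lemma totally_positive1 : totally_positive (1 : F).
Proof. by move=> s; rewrite rmorph1 ltr01. Qed.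
Lemma totally_positiveM x y :
  totally_positive x -> totally_positive y -> totally_positive (x * y).
Proof. by move=> px py s; rewrite rmorphM mulr_gt0. Qed.
Lemma totally_positiveV x : totally_positive x -> totally_positive x^-1.
Proof. by move=> px s; rewrite fmorphV invr_gt0. Qed.

Lemma narrow_class_rel_refl (I : set F) : narrow_class_rel I I.
Proof.
exists 1; split; [exact: oner_neq0|exact: totally_positive1|].
by rewrite ideal_scale1.
Qed.

Lemma narrow_class_rel_sym (I J : set F) : narrow_class_rel I J -> narrow_class_rel J I.
Proof.
move=> [x [x0 px ->]]; exists x^-1; split; first by rewrite invr_eq0.
  exact: totally_positiveV.
by rewrite ideal_scaleM mulVf // ideal_scale1.
Qed.

Lemma narrow_class_rel_trans (I J K : set F) :
  narrow_class_rel I J -> narrow_class_rel J K -> narrow_class_rel I K.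
Proof.
move=> [x [x0 px ->]] [y [y0 py ->]]; exists (y * x); split; first exact: mulf_neq0.
  exact: totally_positiveM.
by rewrite ideal_scaleM.
Qed.

Lemma bounded_integral_class_reps : exists2 S : set (set F), finite_set S &
  forall I, frac_ideal I -> exists2 x, x != 0 & S (ideal_scale x I).
Proof.
have [m m0 mP] := bounded_class_rep F.
exists ((@submod_set F) @` [set I : submod F | I `<=` (1 : submod F) /\ I m%:R]).
  exact/finite_image/integral_bounded_finite.
move=> I' /[dup] fI /frac_submod[I EI]; rewrite -EI in fI *.
have [x x0 HI] := mP I fI; exists x => //.
by exists (principal x * I) => //; rewrite ideal_scaleE.
Qed.

Lemma class_group_finite : finite_set (@class_group F).
Proof.
have [S fS SP] := bounded_integral_class_reps.
apply: (@classes_finite _ _ _ _ S (fun I J => class_rel I J)) => //.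
- by move=> I _; exact: class_rel_refl.
- by move=> I J _ _; exact: class_rel_sym.
- by move=> I J K _ _ _; exact: class_rel_trans.
- by move=> I /SP[x x0 SI]; exists (ideal_scale x I) => //; exists x.
- by move=> I J K _ _ IK /class_rel_sym; exact: class_rel_trans.
Qed.

(** An embedding is determined by the images of a basis of integers, which are
    roots of fixed polynomials. *)
Lemma finitely_many_embeddings : exists (U : finType) (code : {rmorphism F -> algC} -> U),
  forall s t, code s = code t -> s =1 t.
Proof.
have [D D0 [RD _]] := int_mod_finite F.
pose e i := D%:R * ofcoord (delta_mx 0 i) : F.
have [p pP] : exists p : 'I_(dim F) -> {poly int}, forall i,
    p i \is monic /\ root (map_poly intr (p i)) (e i).
  have [|p pP] := @choice _ _ (fun i (p : {poly int}) =>
    p \is monic /\ root (map_poly intr p) (e i)); last by exists p.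
  by move=> i; have [p mp rp] := RD i; exists p.
have [r rP] : exists r : 'I_(dim F) -> seq algC, forall i (z : algC),
    root (map_poly intr (p i)) z -> z \in r i.
  have [|r rP] := @choice _ _ (fun i (r : seq algC) => forall z : algC,
    root (map_poly intr (p i)) z -> z \in r); last by exists r.
  move=> i; have [r rE] := closed_field_poly_normal (map_poly (intr : int -> algC) (p i)).
  exists r => z; rewrite rE; have [mp _] := pP i.
  rewrite (monicP (monic_map _ mp)) scale1r root_prod_XsubC.
  by [].
pose M := \max_i size (r i).
exists {ffun 'I_(dim F) -> 'I_M.+1}, (fun s => [ffun i => inord (index (s (e i)) (r i))]).
move=> s t /ffunP st.
have se (u : {rmorphism F -> algC}) i : u (e i) \in r i.
  apply: rP; have [_ /rootP pe] := pP i; apply/rootP.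
  have -> : map_poly intr (p i) = map_poly u (map_poly intr (p i)).
    by rewrite -map_poly_comp; apply: eq_map_poly => k /=; rewrite rmorph_int.
  by rewrite horner_map pe rmorph0.
have ste i : s (e i) = t (e i).
  have := st i; rewrite !ffunE => /(congr1 val).
  have lt (u : {rmorphism F -> algC}) : (index (u (e i)) (r i) < M.+1)%N.
    rewrite ltnS (leq_trans (index_size _ _)) // /M.
    exact: (@leq_bigmax _ (fun i => size (r i)) i).
  rewrite /= !inordK // => eqi.
  by rewrite -[LHS](nth_index 0 (se s i)) eqi nth_index.
have rat_lin (u : {rmorphism F -> algC}) (c : rat) x : u (c *: x) = ratr c * u x.
  rewrite -[x in LHS]mul1r scalerAl rmorphM.
  by rewrite -[u c%:A]/((u \o in_alg F) c) fmorph_eq_rat.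
move=> x; rewrite -[x](mulKf (natF_neq0 F D0)).
rewrite -[x]coordvK ofcoord_sum mulr_sumr !rmorphM !rmorph_sum !fmorphV !rmorph_nat.
congr (_ * _); apply: eq_bigr => i _.
by rewrite -scalerAr !rat_lin -/(e i) ste.
Qed.

(** An ideal is reached from one of finitely many representatives by a scaling
    factor, and factors with the same signs at all embeddings have a totally
    positive quotient. *)
Lemma narrow_class_group_finite : totally_real F -> finite_set (@narrow_class_group F).
Proof.
move=> Freal; have [S fS SP] := bounded_integral_class_reps.
have [U [code codeP]] := finitely_many_embeddings.
pose sgn x : {set U} :=
  finset (fun u => `[< exists2 s : {rmorphism F -> algC}, code s = u & 0 < s x >]).
have sgnP x s : (code s \in sgn x) = (0 < s x).
  rewrite inE; apply/asboolP/idP => [[t /codeP st]|]; first by rewrite st.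
  by exists s.
have sgn_pos x y : x != 0 -> y != 0 -> sgn x = sgn y -> totally_positive (x / y).
  move=> x0 y0 xy s; have := sgnP x s; rewrite xy sgnP rmorphM fmorphV.
  have real (z : F) : z != 0 -> (0 < s z) || (s z < 0).
    by move=> z0; rewrite orbC -real_neqr_lt ?real0 // fmorph_eq0.
  have /orP[px|nx] := real x x0; have /orP[py|ny] := real y y0.
  - by move=> _; rewrite divr_gt0.
  - by rewrite px lt_gtF.
  - by rewrite py lt_gtF.
  - by move=> _; rewrite nmulr_rgt0 // invr_lt0.
apply: (@classes_finite _ _ _ _ [set p : set F * {set U} | S p.1 /\ True]
  (fun I p => exists x, [/\ x != 0, p.1 = ideal_scale x I & p.2 = sgn x])) => //.
- by move=> I _; exact: narrow_class_rel_refl.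
- by move=> I J _ _; exact: narrow_class_rel_sym.
- by move=> I J K _ _ _; exact: narrow_class_rel_trans.
- exact: (@finite_setX _ _ S setT).
- by move=> I /SP[x x0 SI]; exists (ideal_scale x I, sgn x) => //; exists x.
move=> I J [K u] _ _ /= [x [x0 -> ->]] [y [y0 KJ uy]]; exists (x / y); split.
- by rewrite mulf_neq0 ?invr_eq0.
- exact: sgn_pos.
by rewrite mulrC -ideal_scaleM KJ ideal_scaleM mulVf // ideal_scale1.
Qed.

Lemma ncard_narrow_class_reps (B : set (set F)) : totally_real F -> narrow_class_reps B ->
  finite_set B /\ ncard B = narrow_class_number F.
Proof.
move=> Freal [Bfrac BP]; have fin := narrow_class_group_finite Freal.
have clB b : B b -> narrow_class_group (class_at [set I : set F | frac_ideal I]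
    (@narrow_class_rel F) b).
  by move=> Bb; apply/classes_ofP; exists b => //; exact: Bfrac.
apply: (@ncard_match _ _ _ _ (fun b C => C b)) => //.
- move=> b Bb; exists (class_at [set I : set F | frac_ideal I] (@narrow_class_rel F) b).
    exact: clB.
  by split; [exact: Bfrac|exact: narrow_class_rel_refl].
- by move=> C /BP[b [[Bb Cb] _]]; exists b.
move=> b b' C C' Bb Bb' HC HC' Cb Cb'; split=> [eb|eC]; last first.
  by have [c [_ cu]] := BP C HC; rewrite -(cu b) // -(cu b') // eC.
move: HC HC' => /classes_ofP[I fI CI] /classes_ofP[I' fI' CI'].
move: Cb Cb'; rewrite -eb CI CI' => -[fb Ib] [_ I'b].
apply/class_atP => //.
- by move=> *; exact: narrow_class_rel_refl.
- by move=> *; exact: narrow_class_rel_sym.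
- by move=> I1 I2 I3 _ _ _; exact: narrow_class_rel_trans.
exact: narrow_class_rel_trans Ib (narrow_class_rel_sym I'b).
Qed.

End ClassNumbers.

(** * The type of a vector *)

Section CuspType.
Variable F : fieldExtType rat.
Implicit Types (x y z u t : F) (I J : submod F).
Local Notation R := (@int_ring F).
Local Notation one := (1 : submod F).
Local Notation "<< x >>" := (principal x).

(** For the line through [x, y], the ideal [a^-1] is its intersection with the
    lattice [R + b], and [(N / K) a^-1] its intersection with [R + N b], both
    read in multiples of [x, y]. *)
Definition cusp_type (N b a K : submod F) x y : Prop :=
  <<x>> + <<y>> * inverse b = a /\ <<x>> * N * b + <<y>> = a * b * K.

Variables (N b a M K : submod F).
Hypotheses (bV : b * inverse b = 1) (aV : a * inverse a = 1).
Hypotheses (NMK : N = M * K) (M1 : M `<=` one) (K1 : K `<=` one).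
Let D := M + K.
Let Q := a * a * b * K.
Local Notation bi := (inverse b).
Local Notation ai := (inverse a).

Lemma mem_sub I J x : I `<=` J -> I x -> J x. Proof. exact. Qed.

Lemma mul_sub_l I J : I `<=` one -> I * J `<=` J.
Proof. by rewrite mulrC; exact: mul_int_sub. Qed.

Lemma modulus_sub1 : D `<=` one. Proof. exact: add_sub. Qed.
Lemma cofactor_sub_modulus : K `<=` D. Proof. exact: addr_sub. Qed.
Lemma divisor_sub_modulus : M `<=` D. Proof. exact: addl_sub. Qed.

Section Vector.
Variables (x y : F).
Hypothesis xyT : cusp_type N b a K x y.

Lemma type_x : a x.
Proof. by have [<- _] := xyT; apply: addl_sub; exact: mem_principal. Qed.

Lemma type_y : (a * b * K)%R y.
Proof. by have [_ <-] := xyT; apply: addr_sub; exact: mem_principal. Qed.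

(** Since [y] lies in [a b K], the contribution of [y] to [a] lies in [a K]. *)
Lemma type_gen_x : <<x>> + a * K = a.
Proof.
apply: submod_eq.
  by apply: add_sub; [exact/principal_sub/type_x|exact: mul_int_sub].
have [<- _] := xyT; apply: add_mono => //.
have -> : (<<x>> + <<y>> * bi) * K = a * K by have [-> _] := xyT.
have -> : a * K = (a * b * K) * bi.
  by transitivity (a * K * (b * bi)); [rewrite bV mulr1|ring].
by apply: mul_mono => //; exact/principal_sub/type_y.
Qed.

(** Since [x] lies in [a], the contribution of [x] to [a b K] lies in
    [a N b], which is [a b K M]. *)
Lemma type_gen_y : <<y>> + a * b * K * M = a * b * K.
Proof.
apply: submod_eq.
  by apply: add_sub; [exact/principal_sub/type_y|exact: mul_int_sub].
have [_ {1}<-] := xyT; rewrite addrC; apply: add_mono => //.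
have -> : a * b * K * M = a * N * b by rewrite NMK; ring.
by do 2!(apply: mul_mono => //); exact/principal_sub/type_x.
Qed.

(** Multiply the equalities [type_gen_x] and [type_gen_y]: the error terms lie in
    [Q K] and [Q M]. *)
Lemma type_gen_xy : <<x * y>> + Q * D = Q.
Proof.
apply: submod_eq.
  apply: add_sub; last exact/mul_int_sub/modulus_sub1.
  apply/principal_sub; have -> : Q = a * (a * b * K) by rewrite /Q; ring.
  by apply: mem_mul; [exact: type_x|exact: type_y].
have {1}-> : Q = (<<x>> + a * K) * (<<y>> + a * b * K * M).
  by rewrite type_gen_x type_gen_y /Q; ring.
rewrite mulrDl; apply: add_sub.
  rewrite mulrDr -principalM; apply: add_mono => //.
  have -> : Q * D = a * (a * b * K * D) by rewrite /Q; ring.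
  apply: mul_mono; first exact/principal_sub/type_x.
  by apply: mul_mono => //; exact: divisor_sub_modulus.
rewrite type_gen_y; apply: subset_trans (@addr_sub _ _ _).
have -> : a * K * (a * b * K) = Q * K by rewrite /Q; ring.
by apply: mul_mono => //; exact: cofactor_sub_modulus.
Qed.

End Vector.

(** In the expansion, [p r x ^ 2] lies in [N b a ^ 2 = Q M], [q s y ^ 2] in
    [b^-1 (a b K) ^ 2 = Q K] and [q r x y] in [Q N]; all three vanish modulo
    [Q D], and only the determinant survives. *)
Lemma type_mul_congr (p q r s : F) x y :
    cusp_type N b a K x y -> R p -> bi q -> (N * b)%R r -> R s ->
  (Q * D)%R ((p * x + q * y) * (r * x + s * y) - (p * s - q * r) * (x * y)).
Proof.
move=> xyT Rp bq Nr Rs; have [ax Jy] := (type_x xyT, type_y xyT).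
have -> : (p * x + q * y) * (r * x + s * y) - (p * s - q * r) * (x * y) =
  p * (r * (x * x)) + s * (q * (y * y)) + 2%:R * (q * r * (x * y)) by ring.
have QKD I : I `<=` D -> Q * I `<=` Q * D by move=> ID; exact: mul_mono.
apply: submodD; first apply: submodD; apply: submodZ => //; last 2 first.
- exact: int_nat.
- apply: (QKD (K * M)); first by apply: subset_trans divisor_sub_modulus; exact: mul_sub_l.
  have -> : Q * (K * M) = bi * (N * b) * (a * (a * b * K)).
    by transitivity (Q * (K * M) * (b * bi)); [rewrite bV mulr1|rewrite NMK /Q; ring].
  by do 4?(apply: mem_mul => //).
- apply: (QKD M divisor_sub_modulus); have -> : Q * M = N * b * (a * a) by rewrite NMK /Q; ring.
  by do 4?(apply: mem_mul => //).
apply: (QKD K cofactor_sub_modulus); have -> : Q * K = bi * (a * b * K * (a * b * K)).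
  by transitivity (Q * K * (b * bi)); [rewrite bV mulr1|rewrite /Q; ring].
by do 4?(apply: mem_mul => //).
Qed.

Lemma type_matrix_sub (p q r s : F) x y : R p -> bi q -> (N * b)%R r -> R s ->
  <<p * x + q * y>> + <<r * x + s * y>> * bi `<=` <<x>> + <<y>> * bi /\
  <<p * x + q * y>> * N * b + <<r * x + s * y>> `<=` <<x>> * N * b + <<y>>.
Proof.
move=> Rp bq Nr Rs; have N1 : N `<=` one.
  by rewrite NMK; apply: subset_trans K1; exact: mul_sub_l.
have mx := mem_principal x; have my := mem_principal y.
have A1 : <<p * x + q * y>> `<=` <<x>> + <<y>> * bi.
  apply/principal_sub; apply: submodD.
    by apply: submodZ => //; exact: addl_sub.
  by apply: addr_sub; rewrite mulrC; exact: mem_mul.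
have A2 : <<r * x + s * y>> `<=` <<x>> * N * b + <<y>>.
  apply/principal_sub; apply: submodD; last by apply: submodZ => //; exact: addr_sub.
  by apply: addl_sub; rewrite [r * x]mulrC -[<<x>> * N * b]mulrA; exact: mem_mul.
split; apply: add_sub => //.
  apply: subset_trans (mul_mono A2 (@subset_refl _ bi)) _.
  have -> : (<<x>> * N * b + <<y>>) * bi = <<x>> * N * (b * bi) + <<y>> * bi by ring.
  by rewrite bV mulr1; apply: add_mono => //; exact: mul_int_sub.
have -> : <<p * x + q * y>> * N * b = <<p * x + q * y>> * (N * b) by ring.
apply: subset_trans (mul_mono A1 (@subset_refl _ (N * b))) _.
have -> : (<<x>> + <<y>> * bi) * (N * b) = <<x>> * N * b + <<y>> * (b * bi) * N by ring.
by rewrite bV mulr1; apply: add_mono => //; exact: mul_int_sub.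
Qed.

(** The inclusions of [type_matrix_sub], for the matrix and for its inverse, give
    equalities. *)
Lemma type_matrix (p q r s : F) x y : R p -> bi q -> (N * b)%R r -> R s ->
    p * s - q * r != 0 -> R (p * s - q * r)^-1 ->
  cusp_type N b a K x y -> cusp_type N b a K (p * x + q * y) (r * x + s * y).
Proof.
move=> Rp bq Nr Rs u0 Ru; set u := p * s - q * r in u0 Ru.
have Rp' : R (u^-1 * p) by exact: intM.
have bq' : bi (- (u^-1 * q)) by apply: submodN; exact: submodZ.
have Nr' : (N * b)%R (- (u^-1 * r)) by apply: submodN; exact: submodZ.
have Rs' : R (u^-1 * s) by exact: intM.
have [s1 s2] := type_matrix_sub x y Rp bq Nr Rs.
have := type_matrix_sub (p * x + q * y) (r * x + s * y) Rs' bq' Nr' Rp'.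
have -> : u^-1 * s * (p * x + q * y) + - (u^-1 * q) * (r * x + s * y) = x.
  by rewrite /u; field.
have -> : - (u^-1 * r) * (p * x + q * y) + u^-1 * p * (r * x + s * y) = y.
  by rewrite /u; field.
by move=> [s1' s2'] [E1 E2]; split; [rewrite -E1|rewrite -E2]; apply: submod_eq.
Qed.

(** The relation [x v - y w = 1] expresses that [1] lies in [a * inverse a]. *)
Lemma unimodular_completion x y : cusp_type N b a K x y ->
  exists v w, [/\ ai v, (ai * bi)%R w & x * v - y * w = 1].
Proof.
move=> [xyT _]; have : (<<x>> * ai + <<y>> * (ai * bi))%R 1.
  have -> : <<x>> * ai + <<y>> * (ai * bi) = 1.
    by transitivity ((<<x>> + <<y>> * bi) * ai); [ring|rewrite xyT aV].
  exact: int1.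
case=> _ /mem_principal_mul[v av ->] [_ /mem_principal_mul[w abw ->] E].
by exists v, (- w); split=> //; [exact: submodN|rewrite mulrN opprK].
Qed.

Lemma type_scale_y u x y : R u -> R u^-1 -> u != 0 ->
  cusp_type N b a K x y -> cusp_type N b a K x (u * y).
Proof.
move=> Ru Rui u0; rewrite /cusp_type principalM.
suff -> : <<u>> = 1 by rewrite mul1r.
apply: submod_eq; first exact/principal_sub.
by rewrite -(principalV u0) mulrC; apply: mul_sub_l; exact/principal_sub.
Qed.

(** A matrix of determinant [1] carrying one unimodular completion to another
    is determined up to the shear [t], which moves its lower left entry by
    multiples of [y y']; comparing [x y] with [x' y'] shows that a suitable
    [t] brings that entry into [N b]. *)
Lemma type_transitive_sl x y x' y' :
    cusp_type N b a K x y -> cusp_type N b a K x' y' ->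
    (Q * D)%R (x' * y' - x * y) ->
  exists p q r s, [/\ R p, bi q, (N * b)%R r, R s &
    [/\ p * s - q * r = 1, p * x + q * y = x' & r * x + s * y = y']].
Proof.
move=> T T' cong.
have [v [w [av bw E]]] := unimodular_completion T.
have [v' [w' [av' bw' E']]] := unimodular_completion T'.
have [ax Jy] := (type_x T, type_y T).
have [ax' Jy'] := (type_x T', type_y T').
set J := a * b * K in Jy Jy'.
have aJ : a * J = Q by rewrite /J /Q; ring.
have ai_a I : ai * (a * I) = I by rewrite mulrA [ai * a]mulrC aV mul1r.
have bi_b I : bi * (b * I) = I by rewrite mulrA [bi * b]mulrC bV mul1r.
(* The lower left entry of the transition matrix without shear. *)
pose c := y' * v - y * v'.
have cbK : (b * K)%R c.
  rewrite -[b * K]ai_a [ai * _]mulrC mulrA; apply: submodB; exact: mem_mul.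
have xxc : (Q * D)%R (x * x' * c).
  have -> : x * x' * c = (x' * y' - x * y) + y * y' * (x' * w - x * w').
    have -> : x * x' * c = x' * y' * (x * v) - x * y * (x' * v') by rewrite /c; ring.
    have -> : x * v = 1 + y * w by rewrite -E; ring.
    have -> : x' * v' = 1 + y' * w' by rewrite -E'; ring.
    ring.
  apply: submodD => //; apply: (mem_sub (I := Q * K)).
    by apply: mul_mono => //; exact: cofactor_sub_modulus.
  have -> : Q * K = J * J * bi.
    by rewrite -[Q * K](bi_b) /Q /J; ring.
  apply: mem_mul; first exact: mem_mul.
  have biE : a * (ai * bi) = bi by rewrite mulrA aV mul1r.
  by rewrite -biE; apply: submodB; exact: mem_mul.
have cD : (b * K * D)%R c.
  (* As x and x' generate a modulo a K, it suffices to test c against x x'. *)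
  have aa : a * a `<=` <<x * x'>> + a * a * K.
    have {1}-> : a * a = (<<x>> + a * K) * (<<x'>> + a * K).
      by rewrite (type_gen_x T) (type_gen_x T').
    have -> : (<<x>> + a * K) * (<<x'>> + a * K) =
      <<x>> * <<x'>> + (<<x>> * (a * K) + a * K * (<<x'>> + a * K)) by ring.
    rewrite -principalM (type_gen_x T'); apply: add_mono => //; apply: add_sub.
      by rewrite -mulrA; apply: mul_mono => //; exact/principal_sub.
    by rewrite mulrAC.
  apply/principal_sub; do 2!apply: (cancel_sub aV).
  have -> : a * (a * (b * K * D)) = Q * D by rewrite /Q; ring.
  have -> : a * (a * <<c>>) = a * a * <<c>> by ring.
  apply: subset_trans (mul_mono aa (@subset_refl _ <<c>>)) _.
  rewrite mulrDl; apply: add_sub; first by rewrite -principalM; exact/principal_sub.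
  have -> : Q * D = a * a * D * (b * K) by rewrite /Q; ring.
  by apply: mul_mono; [apply: mul_mono => //; exact: cofactor_sub_modulus|exact/principal_sub].
have [t [abt Nct]] : exists t, (ai * ai * bi)%R t /\ (N * b)%R (c - t * (y * y')).
  have JJ : J * J `<=` <<y * y'>> + J * J * M.
    have {1}-> : J * J = (<<y>> + J * M) * (<<y'>> + J * M).
      by rewrite (type_gen_y T) (type_gen_y T').
    have -> : (<<y>> + J * M) * (<<y'>> + J * M) =
      <<y>> * <<y'>> + (<<y>> * (J * M) + J * M * (<<y'>> + J * M)) by ring.
    rewrite -principalM (type_gen_y T'); apply: add_mono => //; apply: add_sub.
      by rewrite -mulrA; apply: mul_mono => //; exact/principal_sub.
    by rewrite mulrAC.
  have sub : b * K * D `<=` <<y * y'>> * (ai * ai * bi) + N * b.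
    have -> : b * K * D = b * K * M + b * K * K by rewrite /D; ring.
    apply: add_sub.
      have -> : b * K * M = N * b by rewrite NMK; ring.
      exact: addr_sub.
    have JE : J * J * (ai * ai * bi) = b * K * K.
      transitivity ((a * ai) * (a * ai) * (b * bi) * (b * K * K)).
        by rewrite /J; ring.
      by rewrite aV bV !mul1r.
    rewrite -JE; apply: subset_trans (mul_mono JJ (@subset_refl _ (ai * ai * bi))) _.
    rewrite mulrDl; apply: add_mono => //; rewrite mulrAC JE.
    have -> : b * K * K * M = K * (N * b) by rewrite NMK; ring.
    exact: mul_sub_l.
  have [_ /mem_principal_mul[t abt ->] [n Nn E0]] := sub _ cD.
  exists t; split=> //; have -> : c - t * (y * y') = n by rewrite -E0; ring.
  by [].
have abxy z z' : a z -> J z' -> (K * 1)%R (t * (z * z')).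
  move=> az Jz'; have -> : K * 1 = ai * ai * bi * (a * J).
    rewrite /J; transitivity ((a * ai) * (a * ai) * (b * bi) * K); last by ring.
    by rewrite aV bV !mul1r mulr1.
  by do 2!apply: mem_mul => //.
have R_ax z z' : ai z -> a z' -> R (z * z').
  by move=> az az'; have := mem_mul az az'; rewrite mulrC aV.
have R_wy z z' : (ai * bi)%R z -> J z' -> R (z * z').
  move=> wz Jz'; have := mem_mul wz Jz'.
  have -> : ai * bi * J = (a * ai) * (b * bi) * K by rewrite /J; ring.
  by rewrite aV bV !mul1r; exact: K1.
have bi_wx z z' : (ai * bi)%R z -> a z' -> bi (z * z').
  move=> wz az'; have := mem_mul wz az'.
  have -> : ai * bi * a = (a * ai) * bi by ring.
  by rewrite aV mul1r.
have RK z : (K * 1)%R z -> R z by rewrite mulr1; exact: K1.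
(* The entries of [x' w'; y' v'] [1 t; 0 1] [v -w; -y x], where x v - y w = 1. *)
exists (v * x' - (t * (x' * y) + w' * y)), (t * (x * x') + w' * x - w * x'),
  (c - t * (y * y')), (v' * x + t * (x * y') - w * y').
split=> //.
- apply: intB; first exact: R_ax.
  by apply: intD; [exact/RK/abxy|exact: R_wy].
- apply: submodB; last exact: bi_wx.
  apply: submodD; last exact: bi_wx.
  have -> : bi = ai * ai * bi * (a * a).
    by transitivity ((a * ai) * (a * ai) * bi); [rewrite aV !mul1r|ring].
  by do 2!apply: mem_mul => //.
- apply: intB; last exact: R_wy.
  by apply: intD; [exact: R_ax|exact/RK/abxy].
rewrite /c; split.
- transitivity ((x * v - y * w) * (x' * v' - y' * w')); first by ring.
  by rewrite E E' mul1r.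
- by transitivity (x' * (x * v - y * w)); [ring|rewrite E mulr1].
- by transitivity (y' * (x * v - y * w)); [ring|rewrite E mulr1].
Qed.

(** Multiplying [y] by [u] beforehand reduces to determinant [1]. *)
Lemma type_transitive x y x' y' u :
    u != 0 -> R u -> R u^-1 ->
    cusp_type N b a K x y -> cusp_type N b a K x' y' ->
    (Q * D)%R (x' * y' - u * (x * y)) ->
  exists p q r s, [/\ R p, bi q, (N * b)%R r, R s &
    [/\ p * s - q * r = u, p * x + q * y = x' & r * x + s * y = y']].
Proof.
move=> u0 Ru Ru' T T'; rewrite mulrCA => cong.
have [p [q [r [s [Rp bq Nr Rs [det1 <- <-]]]]]] :=
  type_transitive_sl (type_scale_y Ru Ru' u0 T) T' cong.
exists p, (u * q), r, (u * s); split=> //; [exact: submodZ|exact: intM|].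
split; [|by ring|by ring].
by transitivity (u * (p * s - q * r)); [ring|rewrite det1 mulr1].
Qed.

(** A generator of [Q / Q D] is first written as a product [x1 y1] modulo [Q D];
    then [y1] is lifted to a generator of [J] modulo [J M], and [x1] to an
    element that generates [a] together with [y b^-1].  Neither change affects
    the product modulo [Q D]. *)
Lemma type_exists q (m : nat) : (0 < m)%N -> M m%:R -> K m%:R ->
    K * inverse K = 1 -> <<q>> + Q * D = Q ->
  exists x y, [/\ x != 0, cusp_type N b a K x y & (Q * D)%R (x * y - q)].
Proof.
move=> m0 Mm Km KV qQ; pose J := a * b * K.
have aJ : a * J = Q by rewrite /J /Q; ring.
have JV : J * inverse J = 1 by do 2!(apply: invertibleM => //).
have Qq : Q q by rewrite -qQ; apply: addl_sub; exact: mem_principal.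
have gen0 : <<(0 : F)>> + a * 1 = a.
  rewrite mulr1; apply: submod_eq; last exact: addr_sub.
  by apply: add_sub => //; exact/principal_sub/submod0.
have [x1 [_ _ x1a]] := approximation aV m0 Km K1 (@subset_refl _ one) gen0.
have ax1 : a x1 by rewrite -x1a; apply: addl_sub; exact: mem_principal.
have [y1 [Jy1 qxy1]] : exists y1, J y1 /\ (Q * D)%R (x1 * y1 - q).
  have sub : Q `<=` <<x1>> * J + Q * D.
    rewrite -{1}aJ -{1}x1a mulrDl; apply: add_mono => //.
    have -> : a * K * J = Q * K by rewrite -aJ; ring.
    by apply: mul_mono => //; exact: cofactor_sub_modulus.
  have [_ /mem_principal_mul[y1 Jy1 ->] [r Dr rE]] := sub _ Qq.
  exists y1; split=> //; have -> : x1 * y1 - q = - r by rewrite -rE; ring.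
  exact: submodN.
have y1J : <<y1>> + J * D = J.
  apply: submod_eq; first by apply: add_sub; [exact/principal_sub|exact/mul_int_sub/modulus_sub1].
  apply: (cancel_sub aV); rewrite aJ mulrDr [a * (J * D)]mulrA aJ -[X in submod_set X `<=` _]qQ.
  apply: add_sub; last exact: addr_sub.
  apply/principal_sub; rewrite -[q](subKr (x1 * y1)); apply: submodB; last exact: addr_sub.
  by apply: addl_sub; apply: mem_mul => //; exact: mem_principal.
have [y [y0 yy1 yJ]] := approximation JV m0 Mm divisor_sub_modulus modulus_sub1 y1J.
have Jy : J y by rewrite -yJ; apply: addl_sub; exact: mem_principal.
have yK : <<y>> * bi * ai `<=` K.
  have -> : K = J * bi * ai.
    by transitivity ((a * ai) * (b * bi) * K); [rewrite aV bV !mul1r|rewrite /J; ring].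
  by do 2!(apply: mul_mono => //); exact/principal_sub.
have [m' m'0 ym'] : exists2 m' : nat, (0 < m')%N & (<<y>> * bi * ai)%R m'%:R.
  have fr : frac_ideal (<<y>> * bi * ai)%R.
    apply: frac_mul (frac_inverse aV).
    exact: frac_mul (frac_principal y0) (frac_inverse bV).
  have [_ [z yz z0] _] := fr.
  by apply: pos_int_mem yz z0; [exact: submodP|exact: subset_trans K1].
have [x [x0 xx1 xa]] := approximation aV m'0 ym' yK K1 x1a.
have xT : <<x>> + <<y>> * bi = a.
  rewrite -[RHS]xa; congr (_ + _); transitivity (<<y>> * bi * (a * ai)).
    by rewrite aV mulr1.
  by ring.
exists x, y; split=> //; last first.
  have -> : x * y - q = (x - x1) * y + x1 * (y - y1) + (x1 * y1 - q) by ring.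
  apply: submodD => //; apply: submodD.
    apply: (mem_sub (I := a * K * J)); last exact: mem_mul.
    have -> : a * K * J = Q * K by rewrite -aJ; ring.
    by apply: mul_mono => //; exact: cofactor_sub_modulus.
  by rewrite -aJ -mulrA; exact: mem_mul.
split=> //; rewrite -/J.
have JM : J * M = a * N * b by rewrite /J NMK; ring.
apply: submod_eq.
  apply: add_sub; last exact/principal_sub.
  apply: (@subset_trans _ (J * M)); last exact: mul_int_sub.
  rewrite JM; do 2!(apply: mul_mono => //); apply/principal_sub.
  by rewrite -xT; apply: addl_sub; exact: mem_principal.
rewrite -[X in submod_set X `<=` _]yJ; apply: add_sub; first exact: addr_sub.
rewrite JM -xT.
have -> : (<<x>> + <<y>> * bi) * N * b = <<x>> * N * b + <<y>> * (b * bi) * N by ring.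
rewrite bV mulr1; apply: add_mono => //; apply: mul_int_sub.
by rewrite NMK; apply: subset_trans K1; exact: mul_sub_l.
Qed.
End CuspType.

(** * Residue units modulo totally positive units *)

Section ResidueUnits.
Variable F : fieldExtType rat.
Implicit Types (x y z u r : F) (D : submod F).
Local Notation R := (@int_ring F).
Local Notation one := (1 : submod F).

Lemma units_pos1 : units_pos (1 : F).
Proof.
by split; [exact: oner_neq0|exact: int1|rewrite invr1; exact: int1|exact: totally_positive1].
Qed.

Lemma units_posM u v : units_pos u -> units_pos v -> units_pos (u * v).
Proof.
move=> [u0 Ru Ru' pu] [v0 Rv Rv' pv]; split; first exact: mulf_neq0.
- exact: intM.
- by rewrite invfM; exact: intM.
- exact: totally_positiveM.
Qed.

Lemma units_posV u : units_pos u -> units_pos u^-1.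
Proof.
move=> [u0 Ru Ru' pu]; split; rewrite ?invr_eq0 ?invrK //.
exact: totally_positiveV.
Qed.

Definition units_pos_rel (M C C' : set F) : Prop :=
  exists2 U, units_pos_image M U & C' = coset_mul M C U.

Variable D : submod F.
Hypothesis D1 : D `<=` one.

Lemma add_cosetP x y : add_coset D x = add_coset D y <-> D (y - x).
Proof.
split=> [exy|Dyx].
  have : add_coset D y y by exists 0; [exact: submod0|rewrite addr0].
  by rewrite -exy => -[d Dd <-]; rewrite addrC addKr.
apply/seteqP; split=> _ [d Dd <-].
  by exists (x - y + d); [apply: submodD => //; rewrite -opprB; exact: submodN|ring].
by exists (y - x + d); [exact: submodD|ring].
Qed.

Lemma coset_mulE x y : R x -> R y ->
  coset_mul D (add_coset D x) (add_coset D y) = add_coset D (x * y).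
Proof.
move=> Rx Ry; apply/seteqP; split=> [z [x' [y' [[d Dd <-] [e De <-]]]]|z xyz].
  suff -> : add_coset D ((x + d) * (y + e)) = add_coset D (x * y) by [].
  apply/add_cosetP; have -> : x * y - (x + d) * (y + e) = - (x * e + (y + e) * d) by ring.
  by apply/submodN/submodD; apply: submodZ => //; apply: intD => //; exact: D1.
by exists x, y; split=> //; exists 0; rewrite ?addr0 //; exact: submod0.
Qed.

Lemma quotient_unitsP x : R x ->
  quotient_units D (add_coset D x) <-> principal x + D = 1.
Proof.
move=> Rx; split=> [[_ [_ [a Ra <-]]]|xD].
  rewrite coset_mulE // => /add_cosetP D1xa.
  apply: submod_eq; first by apply: add_sub => //; exact/principal_sub.
  rewrite -{1}principal1; apply/principal_sub; rewrite -[1](subrK (x * a)).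
  apply: submodD; first exact: addr_sub.
  by apply: addl_sub; exists a => //; rewrite mulrC.
split; first by exists x.
have : (principal x + D)%R 1 by rewrite xD; exact: int1.
case=> _ [a Ra <-] [d Dd E]; exists (add_coset D a); first by exists a.
rewrite coset_mulE //; apply/add_cosetP.
by have -> : 1 - x * a = d by rewrite -E; ring.
Qed.

Lemma quotient_units_rep C : quotient_units D C ->
  exists r, [/\ R r, principal r + D = 1 & C = add_coset D r].
Proof.
move=> /[dup] UC [[r Rr rC] _]; exists r; split=> //.
by apply/quotient_unitsP; rewrite ?rC.
Qed.

Lemma units_pos_relP r r' : R r ->
  units_pos_rel D (add_coset D r) (add_coset D r') <->
  exists2 u, units_pos u & D (r' - u * r).
Proof.
move=> Rr; split=> [[_ [u up <-]]|[u up Du]].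
  have [_ Ru _ _] := up; rewrite coset_mulE // => /add_cosetP Dru.
  by exists u => //; rewrite -opprB mulrC; exact: submodN.
have [_ Ru _ _] := up; exists (add_coset D u); first by exists u.
rewrite coset_mulE //; apply/add_cosetP; rewrite -opprB mulrC; exact: submodN.
Qed.

Definition residue_class r : set (set F) :=
  class_at (quotient_units D) (units_pos_rel D) (add_coset D r).

Lemma residue_class_eq r r' : R r -> R r' ->
    principal r + D = 1 -> principal r' + D = 1 ->
  residue_class r = residue_class r' <-> exists2 u, units_pos u & D (r' - u * r).
Proof.
move=> Rr Rr' r1 r1'; rewrite -units_pos_relP //.
have Ur x : R x -> principal x + D = 1 -> quotient_units D (add_coset D x).
  by move=> Rx x1; apply/quotient_unitsP.
apply: class_atP; [| | |exact: Ur|exact: Ur].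
- move=> _ /quotient_units_rep[x [Rx _ ->]]; apply/units_pos_relP => //.
  by exists 1; [exact: units_pos1|rewrite mul1r subrr; exact: submod0].
- move=> _ _ /quotient_units_rep[x [Rx _ ->]] /quotient_units_rep[y [Ry _ ->]].
  move=> /units_pos_relP -/(_ Rx)[u up Dyx]; apply/units_pos_relP => //.
  exists u^-1; first exact: units_posV.
  have [u0 _ Ru' _] := up.
  have -> : x - u^-1 * y = u^-1 * - (y - u * x) by field.
  by apply: submodZ => //; exact: submodN.
- move=> _ _ _ /quotient_units_rep[x [Rx _ ->]] /quotient_units_rep[y [Ry _ ->]]
    /quotient_units_rep[z [Rz _ ->]].
  move=> /units_pos_relP -/(_ Rx)[u up Dyx] /units_pos_relP -/(_ Ry)[v vp Dzy].
  apply/units_pos_relP => //; exists (v * u); first exact: units_posM.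
  have [_ Rv _ _] := vp.
  have -> : z - v * u * x = (z - v * y) + v * (y - u * x) by ring.
  by apply: submodD => //; exact: submodZ.
Qed.

Lemma residue_classes e : classes_of (quotient_units D) (units_pos_rel D) e <->
  exists r, [/\ R r, principal r + D = 1 & e = residue_class r].
Proof.
split=> [/classes_ofP[C /quotient_units_rep[r [Rr r1 ->]] ->]|[r [Rr r1 ->]]].
  by exists r.
by apply/classes_ofP; exists (add_coset D r) => //; exact/quotient_unitsP.
Qed.

Lemma residue_classes_finite (m : nat) : (0 < m)%N -> D m%:R ->
  finite_set (classes_of (quotient_units D) (units_pos_rel D)).
Proof.
move=> m0 Dm; have [s [sR sP]] := int_mod_reps F m0.
apply: sub_finite_set (finite_image residue_class (finite_seq s)).
move=> _ /residue_classes[r [Rr _ ->]]; have [y ys [z Rz E]] := sP r Rr.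
exists y => //; rewrite /residue_class.
suff -> : add_coset D y = add_coset D r by [].
by apply/add_cosetP; rewrite E mulrC; exact: submodZ.
Qed.

End ResidueUnits.

(** * Lines in the plane *)

Section Lines.
Variable F : fieldExtType rat.
Implicit Types (x y : F) (g : 'M[F]_2) (L : {vspace 'cV[F]_2}).

Definition vec2 x y : 'cV[F]_2 := \col_i (if i == 0 then x else y).
Definition mx2 (p q r s : F) : 'M[F]_2 :=
  \matrix_(i, j) if i == 0 then (if j == 0 then p else q) else (if j == 0 then r else s).

Lemma ord2P (i : 'I_2) : i = 0 \/ i = 1.
Proof. by case: i => [[|[|[]]] // lt]; [left|right]; exact: val_inj. Qed.

Lemma vec2E (v : 'cV[F]_2) : v = vec2 (v 0 0) (v 1 0).
Proof. by apply/colP => i; rewrite mxE; case: (ord2P i) => ->. Qed.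

Lemma vec2_eq x y x' y' : vec2 x y = vec2 x' y' <-> x = x' /\ y = y'.
Proof.
by split=> [/colP E|[-> ->] //]; have := E 0; have := E 1; rewrite !mxE.
Qed.

Lemma vec2Z c x y : c *: vec2 x y = vec2 (c * x) (c * y).
Proof. by apply/colP => i; rewrite !mxE; case: ifP. Qed.

Lemma vec2_eq0 x y : (vec2 x y == 0) = (x == 0) && (y == 0).
Proof.
apply/eqP/andP => [/colP E|[/eqP-> /eqP->]].
  by have := E 0; have := E 1; rewrite !mxE => /= -> ->.
by apply/colP => i; rewrite !mxE; case: ifP.
Qed.

Lemma mulmx_vec2 g x y :
  g *m vec2 x y = vec2 (g 0 0 * x + g 0 1 * y) (g 1 0 * x + g 1 1 * y).
Proof.
apply/colP => i; rewrite !mxE !big_ord_recl big_ord0 /= !mxE /= addr0.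
have -> : lift ord0 ord0 = 1 :> 'I_2 by exact: val_inj.
by case: (ord2P i) => -> /=; congr (_ * _ + _).
Qed.

Lemma det2 g : \det g = g 0 0 * g 1 1 - g 0 1 * g 1 0.
Proof.
rewrite (expand_det_row _ 0) !big_ord_recl big_ord0 addr0 /cofactor !det_mx11 !mxE /=.
have -> : lift ord0 ord0 = 1 :> 'I_2 by exact: val_inj.
have -> : lift 1 0 = 0 :> 'I_2 by exact: val_inj.
rewrite !expr0; ring.
Qed.

Definition line x y : {vspace 'cV[F]_2} := <[vec2 x y]>%VS.

Lemma P1_line L : P1 L -> exists x y, vec2 x y != 0 /\ L = line x y.
Proof.
rewrite /P1 /= => L1; have L0 : L != 0%VS by rewrite -dimv_eq0 L1.
exists (vpick L 0 0), (vpick L 1 0); rewrite /line -vec2E vpick0; split=> //.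
apply/esym/eqP; rewrite eqEdim -memvE memv_pick L1 dim_vline vpick0 L0.
by [].
Qed.

Lemma line_P1 x y : vec2 x y != 0 -> P1 (line x y).
Proof. by move=> v0; rewrite /P1 /= dim_vline v0. Qed.

Lemma line_eq x y x' y' : vec2 x' y' != 0 -> line x y = line x' y' <->
  exists2 c, c != 0 & x' = c * x /\ y' = c * y.
Proof.
move=> v0; split=> [E|[c c0 [-> ->]]].
  have : vec2 x' y' \in line x y by rewrite E memv_line.
  move=> /vlineP[c cE]; exists c; last by apply/vec2_eq; rewrite -vec2Z.
  by apply: contraNneq v0 => c0; rewrite cE c0 scale0r.
rewrite /line -vec2Z; apply/eqP; rewrite eqEsubv -!memvE; apply/andP; split.
  by rewrite -{1}[vec2 x y](scalerK c0) memvZ ?memv_line.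
by rewrite memvZ ?memv_line.
Qed.

Lemma line_image g x y : (linfun (mulmx g) @: line x y)%VS =
  line (g 0 0 * x + g 0 1 * y) (g 1 0 * x + g 1 1 * y).
Proof. by rewrite /line limg_line lfunE /= mulmx_vec2. Qed.

End Lines.

(** * Counting cusps *)

Section Cusps.
Variable F : fieldExtType rat.
Hypothesis F_real : totally_real F.
Implicit Types (x y z u r : F) (I J M K D Q : submod F).
Local Notation R := (@int_ring F).
Local Notation one := (1 : submod F).
Local Notation "<< x >>" := (principal x).

(** The image of [c] at each embedding is a nonzero real number. *)
Lemma unit_square_pos (c : F) : c != 0 -> totally_positive (c ^+ 2).
Proof.
by move=> c0 s; rewrite rmorphXn real_exprn_even_gt0 //= fmorph_eq0.
Qed.

Lemma class_group_eq C C' (I J : set F) : class_group C -> class_group C' ->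
  C I -> C' J -> class_rel I J -> C = C'.
Proof.
move=> /classes_ofP[A fA ->] /classes_ofP[A' fA' ->] [fI AI] [fJ AJ] IJ.
apply/class_atP => //.
- by move=> *; exact: class_rel_refl.
- by move=> I1 I2 _ _; exact: class_rel_sym.
- by move=> I1 I2 I3 _ _ _; exact: class_rel_trans.
exact: class_rel_trans AI (class_rel_trans IJ (class_rel_sym AJ)).
Qed.

Lemma integral_frac (I : set F) : integral_ideal I -> frac_ideal I.
Proof.
move=> [sI nz I1]; split=> //; exists 1; split; [exact: oner_neq0|exact: int1|].
by move=> x Ix; rewrite mul1r; exact: I1.
Qed.

Variable N : submod F.
Hypothesis N_ideal : integral_ideal N.

Lemma divisorP (M : set F) : ideal_divisors N M -> exists M0 : submod F,
  [/\ M0 = M :> set F, M0 `<=` one & M0 * inverse M0 = 1] /\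
  let K := N * inverse M0 in [/\ N = M0 * K, K `<=` one & K * inverse K = 1].
Proof.
move=> [/[dup] /integral_frac fM [sM nzM M1]].
move=> [K' /[dup] /integral_frac fK [sK nzK K1] E].
exists (Submod sM); have MV := @frac_invertible _ (Submod sM) fM.
have KV := @frac_invertible _ (Submod sK) fK.
have NMK : N = Submod sM * Submod sK by exact: submod_inj.
have KE : N * inverse (Submod sM) = Submod sK by rewrite NMK mulrAC MV mul1r.
split; first by split.
by move=> K; rewrite /K KE; split.
Qed.

Lemma N_has_int : exists2 m : nat, (0 < m)%N & N m%:R.
Proof. by have [sN [x Nx x0] N1] := N_ideal; exact: (pos_int_mem sN N1 Nx x0). Qed.

Lemma ideal_divisors_finite : finite_set (ideal_divisors N).
Proof.
have [m m0 Nm] := N_has_int.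
apply: sub_finite_set (finite_image (@submod_set F) (integral_bounded_finite F m0)).
move=> M /divisorP[M0 [[<- M1 _] [NE K1 _]]]; exists M0 => //; split=> //.
by rewrite NE in Nm; exact: mul_int_sub Nm.
Qed.

Definition modulus (M : set F) : set F := ideal_add M (ideal_mul N (ideal_inv M)).

Definition residue_classes_mod (M : set F) : set (set (set F)) :=
  classes_of (quotient_units (modulus M)) (units_pos_rel (modulus M)).

Variable rep : set (set F) -> submod F.
Hypothesis repP : forall C, class_group C -> C (rep C).

Variable gen : submod F -> submod F -> F.
Hypothesis genP : forall Q D (m : nat), Q * inverse Q = 1 -> D `<=` one ->
  (0 < m)%N -> D m%:R -> <<gen Q D>> + Q * D = Q.

Variable b : submod F.
Hypothesis bV : b * inverse b = 1.

Definition cusp_invariants : set (set (set F) * (set F * set (set F))) :=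
  [set p | class_group p.1 /\
    [set q : set F * set (set F) | ideal_divisors N q.1 /\ residue_classes_mod q.1 q.2] p.2].

(** The coordinates are normalized to have the chosen ideal [a = rep p.1] of the
    class; the residue class is then that of [x y] in [Q / Q D], measured against
    the chosen generator of this module. *)
Definition has_invariants (L : {vspace 'cV[F]_2})
    (p : set (set F) * (set F * set (set F))) : Prop :=
  exists x y r M, let K := N * inverse M in let a := rep p.1 in
    let Q := a * a * b * K in let D := M + K in
  [/\ vec2 x y != 0 /\ L = line x y, M = p.2.1 :> set F /\ cusp_type N b a K x y,
      R r /\ <<r>> + D = 1, p.2.2 = residue_class D r
    & (Q * D)%R (x * y - r * gen Q D)].

Lemma rep_frac C : class_group C -> frac_ideal (rep C).
Proof. by move=> /[dup] /repP + /classes_ofP[I _ E]; rewrite E => -[]. Qed.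

Lemma rep_inv C : class_group C -> rep C * inverse (rep C) = 1.
Proof. by move=> /rep_frac; exact: frac_invertible. Qed.

Lemma modulus_int M K : N = M * K -> M `<=` one -> K `<=` one ->
  exists m : nat, [/\ (0 < m)%N, M m%:R, K m%:R & (M + K)%R m%:R].
Proof.
move=> NMK M1 K1; have [m m0 Nm] := N_has_int.
have Mm : M m%:R by rewrite NMK in Nm; exact: mul_int_sub Nm.
have Km : K m%:R by rewrite NMK in Nm; exact: mul_sub_l Nm.
by exists m; split=> //; exact: addl_sub.
Qed.

(** One coordinate may vanish, in which case it contributes the zero ideal. *)
Lemma frac_vector x y : vec2 x y != 0 -> frac_ideal (<<x>> + <<y>> * inverse b)%R.
Proof.
move=> v0; have [[d [d0 Rd dx]] [e [e0 Re ey]]] : (exists d, [/\ d != 0, R d &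
   forall z, <<x>> z -> R (d * z)]) /\ (exists d, [/\ d != 0, R d &
   forall z, (<<y>> * inverse b)%R z -> R (d * z)]).
  split.
    have [->|x0] := eqVneq x 0; last by have [_ _] := frac_principal x0.
    exists 1; split; [exact: oner_neq0|exact: int1|].
    by move=> _ [a _ <-]; rewrite !mulr0; exact: int0.
  have [->|y0] := eqVneq y 0; last first.
    by have [_ _] := frac_mul (frac_principal y0) (frac_inverse bV).
  exists 1; split; [exact: oner_neq0|exact: int1|].
  by move=> _ /mem_principal_mul[z _ ->]; rewrite mul0r mulr0; exact: int0.
split; first exact: submodP.
  move: v0; rewrite vec2_eq0 negb_and => /orP[x0|y0].
    by exists x => //; apply: addl_sub; exact: mem_principal.
  have [_ [z z1 z0] _] := frac_mul (frac_principal y0) (frac_inverse bV).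
  by exists z => //; exact: addr_sub.
exists (d * e); split; [exact: mulf_neq0|exact: intM|].
move=> _ [z xz [w yw <-]]; rewrite mulrDr; apply: intD.
  by rewrite mulrAC mulrC; apply: intM => //; exact: dx.
by rewrite -mulrA; apply: intM => //; exact: ey.
Qed.

(** Any coordinates of the line can be scaled to have the chosen ideal of their
    class, and [K] and then [M] are read off the second condition of
    [cusp_type]. *)
Lemma cusp_invariants_total L : P1 L -> exists2 p, cusp_invariants p & has_invariants L p.
Proof.
move=> /P1_line[x0 [y0 [v0 ->]]].
have N1 : N `<=` one by have [] := N_ideal.
pose a0 := <<x0>> + <<y0>> * inverse b; have fa0 : frac_ideal a0 := frac_vector v0.
pose C := class_at [set I : set F | frac_ideal I] (@class_rel F) a0.
have CC : class_group C by apply/classes_ofP; exists (submod_set a0).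
have := repP CC; set a := rep C => -[fa [c c0]].
rewrite ideal_scaleE => /submod_inj aE.
have aV : a * inverse a = 1 by exact: rep_inv.
pose x := c * x0; pose y := c * y0.
have xya : <<x>> + <<y>> * inverse b = a.
  by rewrite aE /a0 !principalM; ring.
pose J := <<x>> * N * b + <<y>>.
pose K := J * inverse b * inverse a.
have KE : a * b * K = J.
  transitivity ((a * inverse a) * (b * inverse b) * J); first by rewrite /K; ring.
  by rewrite aV bV !mul1r.
have K1 : K `<=` one.
  have <- : a * b * inverse b * inverse a = one.
    by rewrite -[a * b * _]mulrA bV mulr1.
  do 2!(apply: mul_mono => //); rewrite -xya /J.
  have -> : (<<x>> + <<y>> * inverse b) * b = <<x>> * b + <<y>> * (b * inverse b) by ring.
  rewrite bV mulr1; apply: add_mono => //; apply: mul_mono => //; exact: mul_int_sub.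
have aJ : a * N * b `<=` J.
  rewrite -xya /J.
  have -> : (<<x>> + <<y>> * inverse b) * N * b =
    <<x>> * N * b + <<y>> * N * (b * inverse b) by ring.
  by rewrite bV mulr1; apply: add_mono => //; exact: mul_int_sub.
have NK : N `<=` K.
  have -> : N = a * N * b * inverse b * inverse a.
    transitivity ((a * inverse a) * (b * inverse b) * N); last by ring.
    by rewrite aV bV !mul1r.
  by do 2!(apply: mul_mono => //).
have fK : frac_ideal K.
  apply: integral_frac; split=> //; first exact: submodP.
  by have [_ [z Nz z0] _] := N_ideal; exists z => //; exact: NK.
have KV : K * inverse K = 1 by exact: frac_invertible.
pose M := N * inverse K.
have NMK : N = M * K by rewrite /M -mulrA [inverse K * K]mulrC KV mulr1.
have M1 : M `<=` one by rewrite -KV; exact: mul_mono.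
have fM : frac_ideal M by apply: frac_mul (integral_frac N_ideal) (frac_inverse KV).
have MV : M * inverse M = 1 by exact: frac_invertible.
have NK' : N * inverse M = K by rewrite NMK mulrAC MV mul1r.
have xyT : cusp_type N b a K x y by split=> //; rewrite KE.
pose D := M + K; pose Q := a * a * b * K.
have QV : Q * inverse Q = 1 by do 3!(apply: invertibleM => //).
have D1' : D `<=` one by exact: add_sub.
have [m [m0 Mm Km Dm]] := modulus_int NMK M1 K1.
have gQ := genP QV D1' m0 Dm.
have Qxy : <<x * y>> + Q * D = Q := type_gen_xy bV NMK M1 K1 xyT.
have [r [Rr rxy]] : exists r, R r /\ (Q * D)%R (x * y - r * gen Q D).
  have : Q (x * y) by rewrite -Qxy; apply: addl_sub; exact: mem_principal.
  have sub : Q `<=` <<gen Q D>> + Q * D by rewrite gQ.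
  move=> /sub[_ [r Rr <-] [d QDd dE]]; exists r; split=> //.
  by have -> : x * y - r * gen Q D = d by rewrite -dE; ring.
have r1 : <<r>> + D = 1.
  apply: submod_eq; first by apply: add_sub => //; exact/principal_sub.
  apply: (cancel_sub QV); rewrite mulr1 [Q * (<<r>> + D)]mulrDr -[X in submod_set X `<=` _]Qxy.
  apply: add_sub; last exact: addr_sub.
  apply/principal_sub; rewrite -[x * y](subrK (r * gen Q D)).
  apply: submodD; first exact: addr_sub.
  have sub : <<gen Q D>> + Q * D `<=` Q by rewrite gQ.
  apply: addl_sub; rewrite [r * _]mulrC; apply: mem_mul; last exact: mem_principal.
  by apply: sub; apply: addl_sub; exact: mem_principal.
exists (C, (M : set F, residue_class D r)).
  split=> //=; split=> /=.
    split; last by exists (submod_set K); [split|rewrite {1}NMK]; move: fK => [].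
    by split; move: fM => [].
  rewrite /residue_classes_mod.
  have -> : modulus M = D by rewrite /modulus /D -NK'.
  by apply/(residue_classes D1'); exists r.
have v1 : vec2 x y != 0 by rewrite -vec2Z scaler_eq0 negb_or c0.
exists x, y, r, M; rewrite /= NK'; split=> //; split=> //.
by apply/line_eq => //; exists c.
Qed.

Lemma cusp_invariants_realized p : cusp_invariants p ->
  exists2 L, P1 L & has_invariants L p.
Proof.
case: p => C [M' e] [CC []]; rewrite /= => /divisorP[M [[<- M1 MV] /= [NMK K1 KV]]].
set K := N * inverse M in NMK K1 KV *; set a := rep C.
have aV : a * inverse a = 1 by exact: rep_inv.
pose D := M + K; pose Q := a * a * b * K.
have D1' : D `<=` one by exact: add_sub.
move=> /(residue_classes D1')[r [Rr r1 eE]].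
have QV : Q * inverse Q = 1 by do 3!(apply: invertibleM => //).
have [m [m0 Mm Km Dm]] := modulus_int NMK M1 K1.
have gQ := genP QV D1' m0 Dm.
have rgQ : <<r * gen Q D>> + Q * D = Q.
  have sub : <<gen Q D>> + Q * D `<=` Q by rewrite gQ.
  apply: submod_eq.
    apply: add_sub; last exact: mul_int_sub.
    apply/principal_sub/submodZ => //; apply: sub.
    by apply: addl_sub; exact: mem_principal.
  have {1}<- : Q * (<<r>> + D) = Q by rewrite r1 mulr1.
  rewrite [Q * (<<r>> + D)]mulrDr; apply: add_sub; last exact: addr_sub.
  have -> : Q * <<r>> = <<r>> * (<<gen Q D>> + Q * D) by rewrite gQ mulrC.
  rewrite [<<r>> * (<<gen Q D>> + _)]mulrDr -principalM; apply: add_mono => //.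
  by apply: mul_sub_l; exact/principal_sub.
have [x [y [x0 xyT xyQ]]] := type_exists bV aV NMK M1 K1 m0 Mm Km KV rgQ.
have v0 : vec2 x y != 0 by rewrite vec2_eq0 negb_and x0.
exists (line x y); first exact: line_P1.
by exists x, y, r, M; split.
Qed.

Lemma same_invariants_equivalent L L' p : cusp_invariants p ->
    has_invariants L p -> has_invariants L' p ->
  exists2 g, Gamma0 N b g & L' = (linfun (mulmx g) @: L)%VS.
Proof.
case: p => C [M' e] [CC []]; rewrite /= => /divisorP[M [[<- M1 MV] /= [NMK K1 KV]]] _.
set K := N * inverse M in NMK K1 KV *; set a := rep C.
have aV : a * inverse a = 1 by exact: rep_inv.
pose D := M + K; pose Q := a * a * b * K.
have D1' : D `<=` one by exact: add_sub.
move=> [x [y [r [M2 /= [[v0 ->] [/submod_inj-> T] [Rr r1] -> xyr]]]]].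
move=> [x' [y' [r' [M3 /= [[v0' ->] [/submod_inj-> T'] [Rr' r1'] E xyr']]]]].
have /(residue_class_eq D1' Rr Rr' r1 r1')[u [u0 Ru Ru' pu] Du] := E.
have QV : Q * inverse Q = 1 by do 3!(apply: invertibleM => //).
have [m [m0 Mm Km Dm]] := modulus_int NMK M1 K1.
have gQ := genP QV D1' m0 Dm.
have Qg : Q (gen Q D).
  have sub : <<gen Q D>> + Q * D `<=` Q by rewrite gQ.
  by apply: sub; apply: addl_sub; exact: mem_principal.
have cong : (Q * D)%R (x' * y' - u * (x * y)).
  have -> : x' * y' - u * (x * y) = (x' * y' - r' * gen Q D)
      - u * (x * y - r * gen Q D) + gen Q D * (r' - u * r) by ring.
  apply: submodD; last exact: mem_mul.
  by apply: submodB => //; exact: submodZ.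
have [p [q [t [s [Rp bq Nt Rs [det Ex Ey]]]]]] :=
  type_transitive bV aV NMK M1 K1 u0 Ru Ru' T T' cong.
exists (mx2 p q t s); last by rewrite line_image !mxE /= Ex Ey.
by split; rewrite ?det2 !mxE //= det; split.
Qed.

(** The image vector agrees with the normalized coordinates of the image line
    up to a factor [c], which is a unit because it fixes the ideal [a]; it
    multiplies [x y] by the totally positive unit [c ^ 2]. *)
Lemma equivalent_same_invariants L g p p' : cusp_invariants p -> cusp_invariants p' ->
    Gamma0 N b g ->
  has_invariants L p -> has_invariants (linfun (mulmx g) @: L)%VS p' -> p = p'.
Proof.
case: p => C [M' e] [CC []]; rewrite /= => /divisorP[M [[<- M1 MV] /= [NMK K1 KV]]] _.
case: p' => C' [M2' e'] [CC' []]; rewrite /= => /divisorP[M2 [[<- M21 M2V] /= [NMK2 K21 K2V]]] _.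
set K := N * inverse M in NMK K1 KV *; set a := rep C.
set K2 := N * inverse M2 in NMK2 K21 K2V *.
have aV : a * inverse a = 1 by exact: rep_inv.
move=> [Rp Rs bq Nt]; rewrite det2 => -[u0 Ru Ru' pu].
set p := g 0 0 in Rp u0 Ru Ru' pu *; set q := g 0 1 in bq u0 Ru Ru' pu *.
set t := g 1 0 in Nt u0 Ru Ru' pu *; set s := g 1 1 in Rs u0 Ru Ru' pu *.
move=> [x [y [r [M3 /= [[v0 ->] [/submod_inj-> T] [Rr r1] -> xyr]]]]].
move=> [x' [y' [r' [M4 /= [[v0' EL] [/submod_inj-> T'] [Rr' r1'] -> xyr']]]]].
move: EL; rewrite line_image -/p -/q -/t -/s => /line_eq -/(_ v0')[c c0 [Ex' Ey']].
have gT : cusp_type N b a K (p * x + q * y) (t * x + s * y).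
  exact: (type_matrix bV NMK M1 K1 Rp bq Nt Rs u0 Ru' T).
have [cA cC] : <<x'>> + <<y'>> * inverse b = <<c>> * a /\
    <<x'>> * N * b + <<y'>> = <<c>> * a * b * K.
  have [E1 E2] := gT; rewrite Ex' Ey' !principalM; split.
    by rewrite -E1; ring.
  by transitivity (<<c>> * (a * b * K)); [rewrite -E2; ring|ring].
have [cA' cC'] := T'.
have aa' : rep C' = <<c>> * a by rewrite -cA' cA.
have eC : C = C'.
  apply: class_group_eq CC CC' (repP CC) (repP CC') _.
  by exists c => //; rewrite ideal_scaleE aa'.
have ca : a = <<c>> * a by rewrite -aa' -eC.
have cc : <<c>> = 1.
  by transitivity (<<c>> * a * inverse a); [rewrite -mulrA aV mulr1|rewrite -ca].
have Rc : R c by have := mem_principal c; rewrite cc.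
have Rc' : R c^-1.
  by have := mem_principal c^-1; rewrite -[<<c^-1>>]mul1r -cc principalV.
have KK : K2 = K.
  have : a * b * K2 = a * b * K by rewrite {1}ca -aa' -cC' cC -ca.
  by move=> E; apply: submod_eq; apply: (cancel_sub (invertibleM aV bV)); rewrite E.
have MM : M2 = M.
  transitivity (N * inverse K); last by rewrite NMK -mulrA KV mulr1.
  by rewrite NMK2 KK -mulrA KV mulr1.
rewrite eC MM; congr (_, (_, _)).
move: r1' xyr'; rewrite -eC MM -/a -/K => r1' xyr'.
set D := M + K in r1 r1' xyr xyr' *; set Q := a * a * b * K in xyr xyr'.
have D1' : D `<=` one by exact: add_sub.
apply/(residue_class_eq D1' Rr Rr' r1 r1').
set w := p * s - q * t in u0 Ru Ru' pu.
exists (c ^+ 2 * w).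
  split; first by rewrite mulf_neq0 ?expf_neq0.
  - by apply: intM => //; exact: intX.
  - by rewrite invfM -exprVn; apply: intM => //; exact: intX.
  - by apply: totally_positiveM => //; exact: unit_square_pos.
have QV : Q * inverse Q = 1 by do 3!(apply: invertibleM => //).
have [m [m0 Mm Km Dm]] := modulus_int NMK M1 K1.
have gQ := genP QV D1' m0 Dm.
have cong := type_mul_congr bV NMK K1 T Rp bq Nt Rs.
have rr : (Q * D)%R ((r' - c ^+ 2 * w * r) * gen Q D).
  have -> : (r' - c ^+ 2 * w * r) * gen Q D =
      - (x' * y' - r' * gen Q D) + c ^+ 2 * w * (x * y - r * gen Q D)
      + c ^+ 2 * ((p * x + q * y) * (t * x + s * y) - w * (x * y)).
    by rewrite Ex' Ey'; ring.
  apply: submodD; last by apply: submodZ => //; exact: intX.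
  apply: submodD; first exact: submodN.
  by apply: submodZ => //; apply: intM => //; exact: intX.
apply/principal_sub/(cancel_sub QV).
rewrite -[X in X * <<_>>]gQ [(_ + Q * D) * _]mulrDl; apply: add_sub.
  by rewrite mulrC -principalM; exact/principal_sub.
apply: mul_int_sub; apply/principal_sub; apply: intB => //.
by do ?[apply: intM => //|exact: intX].
Qed.

Lemma modulus_classes_finite (M : set F) : ideal_divisors N M ->
  finite_set (residue_classes_mod M).
Proof.
move=> /divisorP[M0 [[<- M1 MV] /= [NMK K1 KV]]].
have [m [m0 _ _ Dm]] := modulus_int NMK M1 K1.
have D1' : M0 + N * inverse M0 `<=` one by exact: add_sub.
exact: (@residue_classes_finite _ _ D1' m m0 Dm).
Qed.

Lemma ncard_cusps_component : finite_set (cusps_component N b) /\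
  ncard (cusps_component N b) = (class_number F *
    \big[addn/0%N]_(M \in ideal_divisors N) phi_pos (modulus M))%N.
Proof.
have [fin_q card_q] := ncard_sigma ideal_divisors_finite modulus_classes_finite.
have [fin card] := @ncard_sigma _ _ _ (fun=> _) (class_group_finite F) (fun _ _ => fin_q).
have [|fc ->] := @classes_match _ (@P1 F)
  (fun L L' => exists2 g, Gamma0 N b g & L' = (linfun (mulmx g) @: L)%VS)
  _ cusp_invariants has_invariants fin cusp_invariants_total
  cusp_invariants_realized.
  move=> L L' p p' _ _ Sp Sp' Lp Lp'; split=> [[g Gg E]|E].
    by rewrite E in Lp'; exact: equivalent_same_invariants Sp Sp' Gg Lp Lp'.
  by rewrite -E in Lp'; exact: same_invariants_equivalent Sp Lp Lp'.
by split=> //; rewrite card sum_const ?card_q //; exact: class_group_finite.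
Qed.

End Cusps.

Theorem corollary3p1p23 (F : fieldExtType rat) (F_real : totally_real F)
    (N : set F) (N_ideal : integral_ideal N)
    (B : set (set F)) (B_reps : narrow_class_reps B) :
  finite_set (cusps N B) /\
  ncard (cusps N B) =
    (narrow_class_number F * class_number F *
     \big[addn/0]_(M \in ideal_divisors N)
       phi_pos (ideal_add M (ideal_mul N (ideal_inv M))))%N.
Proof.
have [fB cB] := ncard_narrow_class_reps F_real B_reps.
have [Bfrac _] := B_reps.
have [N0 NE] := frac_submod (integral_frac N_ideal).
have [rep repP] : exists rep : set (set F) -> submod F,
    forall C, class_group C -> C (rep C).
  have [|rep repP] := @choice _ _ (fun C (I : submod F) => class_group C -> C I).
    move=> C; have [/classes_ofP[I fI ->]|nC] := pselect (class_group C).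
      have [J JI] := frac_submod fI; exists J => _; rewrite JI.
      by split=> //; exact: class_rel_refl.
    by exists 1.
  by exists rep.
have [gen genP] : exists gen : submod F -> submod F -> F,
    forall (Q D : submod F) (m : nat), Q * inverse Q = 1 -> D `<=` (1 : submod F) ->
      (0 < m)%N -> D m%:R -> principal (gen Q D) + Q * D = Q.
  have [|g gP] := @choice _ _ (fun (QD : submod F * submod F) (z : F) =>
    forall m : nat, QD.1 * inverse QD.1 = 1 -> QD.2 `<=` (1 : submod F) ->
      (0 < m)%N -> QD.2 m%:R -> principal z + QD.1 * QD.2 = QD.1).
    move=> [Q D] /=.
    have [[m [QV D1 m0 Dm]]|none] := pselect (exists m : nat,
      [/\ Q * inverse Q = 1, D `<=` (1 : submod F), (0 < m)%N & D m%:R]); last first.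
      by exists 0 => m *; case: none; exists m.
    have gen0 : principal (0 : F) + Q * 1 = Q.
      rewrite mulr1; apply: submod_eq; last exact: addr_sub.
      by apply: add_sub => //; exact/principal_sub/submod0.
    have [z [_ _ zQ]] := approximation QV m0 Dm D1 (@subset_refl _ (1 : submod F)) gen0.
    by exists z.
  by exists (fun Q D => g (Q, D)) => Q D; exact: (gP (Q, D)).
have component b : B b -> finite_set (cusps_component N b) /\
    ncard (cusps_component N b) = (class_number F *
      \big[addn/0%N]_(M \in ideal_divisors N) 
        phi_pos (ideal_add M (ideal_mul N (ideal_inv M))))%N.
  move=> /Bfrac fb; have [b0 bE] := frac_submod fb.
  rewrite -bE -NE in fb *; rewrite -NE in N_ideal.
  exact: (ncard_cusps_component F_real N_ideal repP genP (frac_invertible fb)).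
have [fin ->] := ncard_sigma fB (fun b Bb => (component b Bb).1).
split=> //; rewrite -mulnA -cB -sum_const //.
by apply: eq_fsbigr => b /set_mem Bb; exact: (component b Bb).2.
Qed.
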